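(* Let $\Omega\subset\mathbb R^3$ be a bounded domain, let $\tau_m>0$ for $m\ge0$, let $\gamma\in(0,1)$, and assume that the material coefficients satisfy $$\gamma_1>0,\quad\alpha_4\ge0,\quad\alpha_1+\frac{\gamma_2^2}{\gamma_1}\ge0,\quad\alpha_5+\alpha_6-\frac{\gamma_2^2}{\gamma_1}\ge0 .$$ Let $(\boldsymbol v^m,\boldsymbol n^m)_{m\ge0}$ and $(P^{m+\frac12})_{m\ge0}$ be sufficiently smooth fields on $\Omega$ satisfying the midpoint rotational discrete gradient time-discrete scheme (defined in the context) for every $m\ge0$, with $|\boldsymbol n^0|=1$ and $\nabla\cdot\boldsymbol v^0=0$, and assume that either $\boldsymbol v^m|_{\partial\Omega}=\boldsymbol 0$ and $\boldsymbol n^m|_{\partial\Omega}=\boldsymbol g_2(\boldsymbol x)$ for all $m\ge0$ (with $\boldsymbol g_2$ independent of $m$), or periodic boundary conditions are imposed. Then for every $m\ge0$: (i) (unit-length preservation) $|\boldsymbol n^{m+1}|=1$ pointwise in $\Omega$; (ii) (discrete energy dissipation) $$\frac{\mathrm{Re}}{2(1-\gamma)}\|\boldsymbol v^{m+1}\|^2+\mathcal F[\boldsymbol n^{m+1}]\le\frac{\mathrm{Re}}{2(1-\gamma)}\|\boldsymbol v^m\|^2+\mathcal F[\boldsymbol n^m].$$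
   Context: Notation (summation over repeated indices $1,2,3$): $\mathbf p:\mathbf q=p_{ij}q_{ij}$, $(\mathbf p\cdot\boldsymbol n)_i=p_{ij}n_j$, $(\boldsymbol n\cdot\mathbf p)_j=n_ip_{ij}$, $(\boldsymbol m\otimes\boldsymbol n)_{ij}=m_in_j$, $(\nabla\boldsymbol v)_{ij}=\partial_iv_j$, $(\nabla\cdot\mathbf p)_j=\partial_ip_{ij}$; thus $(\boldsymbol v\cdot\nabla\boldsymbol n)_j=v_i\partial_in_j$, $(\nabla\boldsymbol n\cdot\boldsymbol a)_i=(\partial_in_j)a_j$. $\|\cdot\|$ is the $L^2(\Omega)$ norm. Constants: $\mathrm{Re}>0$, $\gamma$, $\kappa_1,\kappa_2,\kappa_3$, Leslie coefficients $\alpha_1,\dots,\alpha_6$ satisfying the Parodi relation $\alpha_2+\alpha_3=\alpha_6-\alpha_5$, and $\gamma_1=\alpha_3-\alpha_2$, $\gamma_2=\alpha_6-\alpha_5$. Oseen--Frank energy: $$\mathcal F[\boldsymbol n]=\frac12\int_\Omega\kappa_1(\nabla\cdot\boldsymbol n)^2+\kappa_2(\boldsymbol n\cdot\nabla\times\boldsymbol n)^2+\kappa_3|\boldsymbol n\times(\nabla\times\boldsymbol n)|^2\,dV .$$ For any quantity $\chi^m$ set $\chi^{m+\frac12}=\frac12(\chi^{m+1}+\chi^m)$. Put $\beta^k=\boldsymbol n^k\cdot\nabla\times\boldsymbol n^k$, $\boldsymbol\omega^k=\boldsymbol n^k\times(\nabla\times\boldsymbol n^k)$ (so $\beta^{m+\frac12},\boldsymbol\omega^{m+\frac12}$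 are the averages of their values at $k=m,m+1$). $\boldsymbol\tau^{m+\frac12}$ and $\boldsymbol\Omega^{m+\frac12}$ are the symmetric and antisymmetric parts of $\nabla\boldsymbol v^{m+\frac12}$: $\boldsymbol\tau=\frac12(\nabla\boldsymbol v+(\nabla\boldsymbol v)^\top)$, $\boldsymbol\Omega=\frac12(\nabla\boldsymbol v-(\nabla\boldsymbol v)^\top)$. Oseen--Frank discrete gradient: $$\begin{aligned}\boldsymbol D^{m+\frac12}=&-\kappa_1\nabla(\nabla\cdot\boldsymbol n^{m+\frac12})+\kappa_2\big(\beta^{m+\frac12}\nabla\times\boldsymbol n^{m+\frac12}+\nabla\times(\beta^{m+\frac12}\boldsymbol n^{m+\frac12})\big)\\&+\kappa_3\big((\nabla\times\boldsymbol n^{m+\frac12})\times\boldsymbol\omega^{m+\frac12}+\nabla\times(\boldsymbol\omega^{m+\frac12}\times\boldsymbol n^{m+\frac12})\big).\end{aligned}$$ Write $\boldsymbol q^{m+\frac12}=(\boldsymbol n^{m+\frac12}\times\boldsymbol D^{m+\frac12})\times\boldsymbol n^{m+\frac12}$. Discrete Leslie stress (all quantities on the right at level $m+\frac12$): $$\begin{aligned}\widehat{\boldsymbol\sigma}^{\mathrm L}\big|^{m+\frac12}=&\Big(\alpha_1+\frac{\gamma_2^2}{\gamma_1}\Big)(\boldsymbol n\otimes\boldsymbol n:\boldsymbol\tau)\,\boldsymbol n\otimes\boldsymbol n-\frac{\alpha_2}{\gamma_1}\boldsymbol n\otimes\boldsymbol q-\frac{\alpha_3}{\gamma_1}\boldsymbol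 q\otimes\boldsymbol n+\alpha_4\boldsymbol\tau\\&+\Big(\frac{\alpha_5+\alpha_6}2-\frac{\gamma_2^2}{2\gamma_1}\Big)\big(\boldsymbol n\otimes(\boldsymbol\tau\cdot\boldsymbol n)+(\boldsymbol\tau\cdot\boldsymbol n)\otimes\boldsymbol n\big).\end{aligned}$$ Midpoint rotational discrete gradient time-discrete scheme: for each $m\ge0$, given $(\boldsymbol v^m,\boldsymbol n^m)$ with $\nabla\cdot\boldsymbol v^m=0$ and $|\boldsymbol n^m|=1$, $(\boldsymbol v^{m+1},\boldsymbol n^{m+1},P^{m+\frac12})$ satisfies in $\Omega$ $$\begin{aligned} \frac{\boldsymbol v^{m+1}-\boldsymbol v^m}{\tau_m}=&-\boldsymbol v^{m+\frac12}\cdot\nabla\boldsymbol v^{m+\frac12}-\nabla P^{m+\frac12}+\frac{\gamma}{\mathrm{Re}}\Delta\boldsymbol v^{m+\frac12}+\frac{1-\gamma}{\mathrm{Re}}\nabla\cdot\widehat{\boldsymbol\sigma}^{\mathrm L}\big|^{m+\frac12}+\frac{1-\gamma}{\mathrm{Re}}\nabla\boldsymbol n^{m+\frac12}\cdot\boldsymbol q^{m+\frac12},\\ \frac{\boldsymbol n^{m+1}-\boldsymbol n^m}{\tau_m}=&-\frac1{\gamma_1}\Big(\boldsymbol n^{m+\frac12}\times\big[\boldsymbol D^{m+\frac12}+\gamma_1(\boldsymbol v^{m+\frac12}\cdot\nabla\boldsymbol n^{m+\frac12}+\boldsymbol\Omega^{m+\frac12}\cdot\boldsymbol n^{m+\frac12})+\gamma_2\boldsymbol\tau^{m+\frac12}\cdot\boldsymbol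 n^{m+\frac12}\big]\Big)\times\boldsymbol n^{m+\frac12},\\ \nabla\cdot\boldsymbol v^{m+1}=&\,0 . \end{aligned}$$ *)

(* Defs.v *)
From HB Require Import structures.
From mathcomp Require Import all_boot all_order all_algebra.
From mathcomp Require Import all_classical all_reals all_analysis.
Set Implicit Arguments.
Unset Strict Implicit.
Unset Printing Implicit Defensive.
Import Order.TTheory GRing.Theory Num.Theory.
Import numFieldNormedType.Exports.
Local Open Scope classical_set_scope.
Local Open Scope ring_scope.

(* Points and vectors of R^3 are row vectors;
   a field on a domain is a total function of which only the values on (the
   closure of) that domain matter. *)
Notation vec R := ('rV[R]_3).

Section Algebra.
Context {R : realType}.
Implicit Types (u w : vec R) (p q : 'M[R]_3).

Definition ebase (i : 'I_3) : vec R := delta_mx 0 i.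

Definition dotv u w : R := \sum_i u 0 i * w 0 i.

(* The library norm on 'rV is the sup norm, hence this one. *)
Definition enorm u : R := Num.sqrt (dotv u u).

(* Indices are added modulo 3 in 'I_3. *)
Definition crossv u w : vec R :=
  \row_i (u 0 (i + 1) * w 0 (i + 2) - u 0 (i + 2) * w 0 (i + 1)).

Definition tensv u w : 'M[R]_3 := \matrix_(i, j) (u 0 i * w 0 j).

Definition ddot p q : R := \sum_i \sum_j p i j * q i j.

(* (p . u)_i = p_ij u_j; the product (u . p)_j = u_i p_ij is just u *m p. *)
Definition mulmv p u : vec R := \row_i \sum_j p i j * u 0 j.

Definition vec3 (a b c : R) : vec R :=
  \row_i (if i == 0 then a else if i == 1 then b else c).

End Algebra.

Section Calculus.
Context {R : realType}.
Implicit Types (f : vec R -> R) (v : vec R -> vec R) (s : vec R -> 'M[R]_3).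

Definition pd (i : 'I_3) f : vec R -> R := fun x => 'D_(ebase i) f x.

Definition grad f : vec R -> vec R := fun x => \row_i pd i f x.

(* Convention: (grad v)_ij = d_i v_j, (div s)_j = d_i s_ij. *)
Definition gradv v : vec R -> 'M[R]_3 :=
  fun x => \matrix_(i, j) pd i (fun y => v y 0 j) x.

Definition divv v : vec R -> R := fun x => \sum_i pd i (fun y => v y 0 i) x.

Definition divm s : vec R -> vec R :=
  fun x => \row_j \sum_i pd i (fun y => s y i j) x.

Definition curl v : vec R -> vec R := fun x =>
  \row_i (pd (i + 1) (fun y => v y 0 (i + 2)%R) x
          - pd (i + 2) (fun y => v y 0 (i + 1)%R) x).

Definition laplv v : vec R -> vec R :=
  fun x => \row_j \sum_i pd i (pd i (fun y => v y 0 j)) x.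

(* C^k up to the boundary: f is continuous on the closure of U, and its partial
   derivatives of order at most k exist in U and extend continuously to the
   closure of U. *)
Fixpoint Ck (U : set (vec R)) (k : nat) f : Prop :=
  {within closure U, continuous f} /\
  if k is k'.+1 then
    forall i, exists2 g : vec R -> R,
      (forall x, U x -> is_derive x (ebase i) f (g x)) & Ck U k' g
  else True.

Definition Ckv (U : set (vec R)) (k : nat) v : Prop :=
  forall i, Ck U k (fun x => v x 0 i).

Local Notation mu := (@lebesgue_measure R).

Definition int3 (Omega : set (vec R)) f : R :=
  (\int[((mu \x mu) \x mu)%E]_(p in [set p | Omega (vec3 p.1.1 p.1.2 p.2)])
     f (vec3 p.1.1 p.1.2 p.2))%R.

Definition L2norm (Omega : set (vec R)) v : R :=
  Num.sqrt (int3 Omega (fun x => enorm (v x) ^+ 2)).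

End Calculus.

Record material (R : realType) := Material {
  Rey : R;
  gam : R;
  kap1 : R; kap2 : R; kap3 : R;
  al1 : R; al2 : R; al3 : R; al4 : R; al5 : R; al6 : R }.

Definition gam1 (R : realType) (c : material R) : R := al3 c - al2 c.
Definition gam2 (R : realType) (c : material R) : R := al6 c - al5 c.

Section Scheme.
Context {R : realType}.
Variable c : material R.

Definition beta (n : vec R -> vec R) : vec R -> R :=
  fun x => dotv (n x) (curl n x).

Definition omega (n : vec R -> vec R) : vec R -> vec R :=
  fun x => crossv (n x) (curl n x).

Definition oseen_frank (Omega : set (vec R)) (n : vec R -> vec R) : R :=
  2^-1 * int3 Omega (fun x =>
    kap1 c * divv n x ^+ 2
    + kap2 c * beta n x ^+ 2
    + kap3 c * enorm (omega n x) ^+ 2).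

Definition mid (V : lmodType R) (f0 f1 : vec R -> V) : vec R -> V :=
  fun x => 2^-1 *: (f1 x + f0 x).

Definition strain (v : vec R -> vec R) : vec R -> 'M[R]_3 :=
  fun x => 2^-1 *: (gradv v x + (gradv v x)^T).

Definition spin (v : vec R -> vec R) : vec R -> 'M[R]_3 :=
  fun x => 2^-1 *: (gradv v x - (gradv v x)^T).

(* Not a function of the midpoint director alone: beta and omega are averaged
   after being evaluated at the two time levels. *)
Definition discrete_gradient (n0 n1 : vec R -> vec R) : vec R -> vec R :=
  let nh := mid n0 n1 in
  let bh : vec R -> R := mid (V := R^o) (beta n0) (beta n1) in
  let oh := mid (omega n0) (omega n1) in
  fun x =>
    - (kap1 c *: grad (divv nh) x)
    + kap2 c *: (bh x *: curl nh x + curl (fun y => bh y *: nh y) x)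
    + kap3 c *: (crossv (curl nh x) (oh x)
                 + curl (fun y => crossv (oh y) (nh y)) x).

Definition qfield (n0 n1 : vec R -> vec R) : vec R -> vec R :=
  let nh := mid n0 n1 in
  fun x => crossv (crossv (nh x) (discrete_gradient n0 n1 x)) (nh x).

Definition leslie_stress (v0 v1 n0 n1 : vec R -> vec R) : vec R -> 'M[R]_3 :=
  fun x =>
    let n := mid n0 n1 x in
    let q := qfield n0 n1 x in
    let t := strain (mid v0 v1) x in
    ((al1 c + gam2 c ^+ 2 / gam1 c) * ddot (tensv n n) t) *: tensv n n
    - (al2 c / gam1 c) *: tensv n q
    - (al3 c / gam1 c) *: tensv q n
    + al4 c *: t
    + ((al5 c + al6 c) / 2 - gam2 c ^+ 2 / (2 * gam1 c))
      *: (tensv n (mulmv t n) + tensv (mulmv t n) n).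

Definition momentum_eq (Omega : set (vec R)) (dt : R)
    (v0 v1 n0 n1 : vec R -> vec R) (P : vec R -> R) : Prop :=
  let vh := mid v0 v1 in
  let nh := mid n0 n1 in
  forall x, Omega x ->
    dt^-1 *: (v1 x - v0 x) =
      - (vh x *m gradv vh x)
      - grad P x
      + (gam c / Rey c) *: laplv vh x
      + ((1 - gam c) / Rey c) *: divm (leslie_stress v0 v1 n0 n1) x
      + ((1 - gam c) / Rey c) *: mulmv (gradv nh x) (qfield n0 n1 x).

Definition director_eq (Omega : set (vec R)) (dt : R)
    (v0 v1 n0 n1 : vec R -> vec R) : Prop :=
  let vh := mid v0 v1 in
  let nh := mid n0 n1 in
  forall x, Omega x ->
    dt^-1 *: (n1 x - n0 x) =
      - ((gam1 c)^-1 *: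
         crossv
           (crossv (nh x)
              (discrete_gradient n0 n1 x
               + gam1 c *: (vh x *m gradv nh x + mulmv (spin vh x) (nh x))
               + gam2 c *: mulmv (strain vh x) (nh x)))
           (nh x)).

Definition midpoint_step (Omega : set (vec R)) (dt : R)
    (v0 v1 n0 n1 : vec R -> vec R) (P : vec R -> R) : Prop :=
  [/\ momentum_eq Omega dt v0 v1 n0 n1 P,
      director_eq Omega dt v0 v1 n0 n1
    & forall x, Omega x -> divv v1 x = 0].

End Scheme.

Section Domain.
Context {R : realType}.
Implicit Types (Omega U : set (vec R)) (v n : nat -> vec R -> vec R)
  (P : nat -> vec R -> R).

Definition bounded_domain Omega : Prop :=
  [/\ Omega !=set0, open Omega, connected Omega & bounded_set Omega].

(* The stress contains second derivatives of n and enters the momentum equation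
   through its divergence, so the scheme involves three derivatives of n, two of
   v and one of the pressure. *)
Definition smooth_fields U v n P : Prop :=
  forall m, [/\ Ckv U 2 (v m), Ckv U 3 (n m) & Ck U 1 (P m)].

(* For open Omega, the set below is the topological boundary. *)
Definition dirichlet_bc Omega v n : Prop :=
  exists g2 : vec R -> vec R,
  forall m x, (closure Omega `\` Omega) x -> v m x = 0 /\ n m x = g2 x.

Definition periodic_field (T : Type) (l : vec R) (f : vec R -> T) : Prop :=
  forall i x, f (x + l 0 i *: ebase i) = f x.

(* Omega is the periodicity cell of fields defined on the whole space. *)
Definition periodic_bc Omega v n P : Prop :=
  exists a b : vec R,
  [/\ forall i, a 0 i < b 0 i,
      Omega = [set x | forall i, a 0 i < x 0 i < b 0 i]
    & forall m, [/\ periodic_field (b - a) (v m), periodic_field (b - a) (n m)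
                  & periodic_field (b - a) (P m)]].

End Domain.

(* Main.v *)
(* The increment of the director is a multiple of (n x _) x n at the midpoint
   director n, hence orthogonal to it; this gives the unit length.

   For the energy, test the momentum equation with the midpoint velocity and the
   director increment w with the discrete gradient D.  The discrete gradient is
   built so that F[n1] - F[n0] = int D . w up to divergences, and by Parodi's
   relation the stress power sigma : grad v compensates all terms of the director
   equation that are linear in q, so that pointwise the energy increment is at most
   a sum of divergences of products z * f, where z is a component of the midpoint
   velocity or of w.

   Such a divergence integrates to zero.  In the periodic case this is the
   fundamental theorem of calculus on lines.  In the Dirichlet case no regularity of
   the boundary is available: on each line the product phi, which tends to 0 at the
   boundary of the section of the domain, is replaced by shrink e phi, which is 0
   where |phi| <= e and therefore extends by 0 to a C^1 function.  Letting e tend to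
   0 the derivative converges to phi' outside {phi = 0, phi' <> 0}, which is
   countable because its points are isolated. *)
Require Import Defs.
From HB Require Import structures.
From mathcomp Require Import all_boot all_order all_algebra.
From mathcomp Require Import all_classical all_reals all_analysis.
From mathcomp Require Import measurable_realfun ring lra.
Import Order.TTheory GRing.Theory Num.Theory.
Import numFieldNormedType.Exports.
Set Implicit Arguments.
Unset Strict Implicit.
Unset Printing Implicit Defensive.
Local Open Scope classical_set_scope.
Local Open Scope ring_scope.

(** * Integrating a derivative over an open subset of the line *)

Section cutoff.
Context {R : realType}.
Implicit Types (e s t : R).

(* Equals (s - e)^2 / s for s > e, so that it is C^1 with derivative 1 - (e / s)^2. *)
Definition pshrink e s : R := if e < s then s - 2 * e + e ^+ 2 / s else 0.

(** With [Num.max] one formula covers both branches: for s <= e the quotient is 1 and the derivative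
    0. Only the junction s = e needs difference quotients; there they are 0 or h / (h + e). *)
Lemma is_derive_pshrink e s : 0 < e ->
  is_derive s 1 (pshrink e) (1 - (e / Num.max s e) ^+ 2).
Proof.
move=> e0; case: (ltgtP s e) => [se|es|->].
- rewrite divff ?gt_eqF// expr1n subrr.
  apply: (near_eq_is_derive (f := cst 0)).
  near=> t; rewrite /pshrink ifF//; apply/negbTE; rewrite -leNgt.
  by near: t; exact: lt_le_nbhsl.
- have s0 : s != 0 by rewrite gt_eqF// (lt_trans e0).
  apply: (near_eq_is_derive (f := fun t : R => t + - (2 * e) + e ^+ 2 *: t^-1)).
    near=> t; rewrite /pshrink ifT//.
    by near: t; exact: lt_nbhsr.
  have H := @is_deriveV R id s 1 1 s0 (is_derive_id _ _).
  apply: is_derive_eq; rewrite subr0 /GRing.scale/=.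
  by field.
- rewrite divff ?gt_eqF// expr1n subrr.
  suff K : h^-1 *: (pshrink e (h *: 1 + e) - pshrink e e) @[h --> 0^'] --> (0:R).
    by apply: DeriveDef; [apply/cvg_ex; exists 0|exact/cvg_lim].
  apply/cvgr0Pnorm_lt => d d0; near=> h.
  have h0 : h != 0 by near: h; exact: nbhs_dnbhs_neq.
  have -> : pshrink e e = 0 by rewrite /pshrink ltxx.
  rewrite /pshrink subr0 [h *: 1]mulr1 ltrDr.
  case: ifPn => [hp|_]; last by rewrite scaler0 normr0.
  have -> : h^-1 *: (h + e - 2 * e + e ^+ 2 / (h + e)) = h / (h + e) :> R.
    rewrite /GRing.scale/=; field; rewrite h0 gt_eqF//; exact: addr_gt0.
  rewrite ger0_norm ?divr_ge0 ?addr_ge0 ?ltW//.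
  (* The bound h < d * e suffices, since d * h >= 0. *)
  rewrite ltr_pdivrMr ?addr_gt0// mulrDr.
  rewrite ltr_wpDl ?mulr_ge0 ?ltW//.
  have : `|h| < d * e by near: h; apply: dnbhs0_lt; exact: mulr_gt0.
  by apply: le_lt_trans; exact: ler_norm.
Unshelve. all: by end_near. Qed.

Lemma pshrink_deriv_itv e s : 0 < e -> 0 <= 1 - (e / Num.max s e) ^+ 2 <= 1.
Proof.
move=> e0; have m0 : 0 < Num.max s e by rewrite lt_max e0 orbT.
have q0 : 0 <= e / Num.max s e by rewrite divr_ge0 ?ltW.
rewrite subr_ge0 gerBl exprn_ge0// andbT expr_le1//.
by rewrite ler_pdivrMr// mul1r le_max lexx orbT.
Qed.

Lemma continuous_pshrink_deriv e : 0 < e ->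
  continuous (fun s => 1 - (e / Num.max s e) ^+ 2 : R).
Proof.
move=> e0 s; have m0 : 0 < Num.max s e by rewrite lt_max e0 orbT.
apply: cvgB; first exact: cvg_cst.
have c : {for s, continuous (fun s => e / Num.max s e : R)}.
  apply: cvgMr; apply: cvgV; first by rewrite gt_eqF.
  by apply: (@continuous_max R R id (cst e)) => //; exact: cvg_cst.
under eq_fun do rewrite expr2.
exact: cvgM.
Qed.

(** The odd version of [pshrink]: for e > 0 at most one of the two terms is nonzero. *)
Definition shrink e s : R := pshrink e s - pshrink e (- s).
Definition dshrink e s : R :=
  (1 - (e / Num.max s e) ^+ 2) + (1 - (e / Num.max (- s) e) ^+ 2).

Lemma is_derive_shrink e s : 0 < e -> is_derive s 1 (shrink e) (dshrink e s).
Proof.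
move=> e0; have H1 := is_derive_pshrink s e0.
have H2 := is_derive1_comp (is_derive_pshrink (- s) e0) (is_deriveNid s 1).
have H := is_deriveB H1 H2.
by apply: is_derive_eq; rewrite mulrN1 opprK.
Qed.

Lemma continuous_dshrink e : 0 < e -> continuous (dshrink e).
Proof.
move=> e0 s; apply: cvgD; first exact: continuous_pshrink_deriv.
apply: (@continuous_comp _ _ _ -%R (fun s => 1 - (e / Num.max s e) ^+ 2 : R)).
  exact: oppr_continuous.
exact: continuous_pshrink_deriv.
Qed.

(** Each of the two summands lies in [0, 1]. A bound uniform in e is what dominated convergence asks
    for. *)
Lemma dshrink_bound e s : 0 < e -> `|dshrink e s| <= 2.
Proof.
move=> e0; have /andP[a0 a1] := pshrink_deriv_itv s e0.
have /andP[b0 b1] := pshrink_deriv_itv (- s) e0.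
by rewrite /dshrink ger0_norm; [exact: lerD|exact: addr_ge0].
Qed.

Lemma shrink_small e s : `|s| <= e -> shrink e s = 0.
Proof.
rewrite ler_norml lerNl => /andP[h1 h2].
by rewrite /shrink /pshrink !ifF ?subr0//; apply/negbTE; rewrite -leNgt.
Qed.

Lemma dshrink_small e s : 0 < e -> `|s| <= e -> dshrink e s = 0.
Proof.
move=> e0; rewrite ler_norml lerNl => /andP[h1 h2].
by rewrite /dshrink !max_r// divff ?gt_eqF// expr1n subrr addr0.
Qed.

(** Once e = 1 / (n + 1) is at most |s|, one summand vanishes and the other equals 1 - (e /
    |s|)^2. *)
Lemma dshrink_cvg s : s != 0 -> dshrink n.+1%:R^-1 s @[n --> \oo] --> (1 : R).
Proof.
move=> s0.
have K : 1 - (n.+1%:R^-1 / `|s|) * (n.+1%:R^-1 / `|s|) @[n --> \oo] --> (1 : R).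
  have L : n.+1%:R^-1 / `|s| @[n --> \oo] --> (0:R).
    by rewrite -[X in _ --> X](mul0r `|s|^-1); apply: cvgMl; exact: cvg_harmonic.
  have := cvgB (cvg_cst (1 : R)) (cvgM L L).
  by rewrite mul0r subr0; exact.
apply: cvg_trans K; apply: near_eq_cvg; near=> n.
have ns : n.+1%:R^-1 <= `|s|.
  have : `|n.+1%:R^-1 - 0 : R| <= `|s|.
    near: n; apply: cvgr_distC_le; [exact: cvg_harmonic|by rewrite normr_gt0].
  by rewrite subr0 ger0_norm// invr_ge0.
have n0 : 0 < n.+1%:R^-1 :> R by rewrite invr_gt0.
rewrite -expr2 /dshrink; case: (ltgtP s 0) (s0) ns => // [sn|sp] _.
  rewrite ltr0_norm// => ns.
  rewrite (max_l ns) [Num.max s _]max_r ?(le_trans (ltW sn)) ?ltW//.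
  by rewrite divff ?gt_eqF// expr1n subrr add0r.
rewrite gtr0_norm// => ns.
rewrite (max_l ns) [Num.max (- s) _]max_r; last first.
  by rewrite (le_trans _ (ltW n0))// oppr_le0 ltW.
by rewrite divff ?gt_eqF// expr1n subrr addr0.
Unshelve. all: by end_near. Qed.

End cutoff.

(** * Derivatives of functions vanishing at the boundary of an open set of the line *)

Section one_dim.
Context {R : realType}.
Local Notation mu := (@lebesgue_measure R).
Implicit Types (U : set R) (phi psi : R -> R) (t e : R).

Lemma is_derive1_continuous phi t d : is_derive t 1 phi d ->
  {for t, continuous phi}.
Proof.
by move=> H; apply/differentiable_continuous/derivable1_diffP; exact: ex_derive.
Qed.

Lemma exists_inv_natS (e : R) : 0 < e -> exists n : nat, n.+1%:R^-1 < e.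
Proof.
move=> e0; exists (Num.bound e^-1); rewrite invf_plt ?posrE//.
apply: lt_le_trans (archi_boundP _) _; first by rewrite invr_ge0 ltW.
by rewrite ler_nat.
Qed.

(** Difference quotients close to d are nonzero. The radius has the form 1 / (n + 1) so that such
    zeros can be sorted into countably many classes. *)
Lemma is_derive_isolated phi t d : d != 0 -> is_derive t 1 phi d ->
  phi t = 0 ->
  exists n : nat, forall s, s != t -> `|s - t| < n.+1%:R^-1 -> phi s != 0.
Proof.
move=> d0 [H1 H2] pt.
have K : h^-1 *: ((phi \o shift t) (h *: 1) - phi t) @[h --> 0^'] --> d.
  by rewrite -H2; exact: H1.
have := cvgr_neq0 d K d0.
rewrite pt near_withinE => /(_ _)/nbhs_norm0P[e /= e0 He].
have [n ne] := exists_inv_natS e0.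
exists n => s st sn.
have : s - t != 0 by rewrite subr_eq0.
have /= := He _ (lt_trans sn ne) => /[apply].
rewrite [(s - t) *: 1]mulr1 subrK subr0.
by apply: contraNneq => ->; rewrite scaler0.
Qed.

(** The map t |-> floor (t * (n + 1)) is injective on A: equal floors force a distance below 1 / (n
    + 1). *)
Lemma countable_isolated (A : set R) (n : nat) :
  (forall s t, A s -> A t -> `|s - t| < n.+1%:R^-1 -> s = t) -> countable A.
Proof.
move=> H; apply/countable_injP.
exists (fun t => pickle (Num.floor (t * n.+1%:R))) => s t.
rewrite !inE => As At /(pcan_inj (@pickleK _)) E; apply: H => //.
have /andP[s1 s2] := floor_itv (s * n.+1%:R).
have /andP[t1 t2] := floor_itv (t * n.+1%:R).
rewrite -[ltLHS](mulfK (_ : n.+1%:R != 0))// ltr_pdivrMr// mulVf//.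
rewrite -[X in _ * X](@ger0_norm _ n.+1%:R)// -normrM mulrBl.
move: s1 s2 t1 t2; rewrite -E !intrD => s1 s2 t1 t2.
rewrite ltr_norml; apply/andP; split; lra.
Qed.

(** This is the exceptional set of the passage to the limit e -> 0. It is a countable union over the
    isolation radius 1 / (n + 1). *)
Lemma countable_nondegenerate_zeros U phi psi :
  (forall t, U t -> is_derive t 1 phi (psi t)) ->
  countable [set t | [/\ U t, phi t = 0 & psi t != 0]].
Proof.
move=> dphi.
pose A n := [set t | phi t = 0 /\
  forall s, s != t -> `|s - t| < n.+1%:R^-1 -> phi s != 0].
apply: (@sub_countable _ _ _ (\bigcup_n A n)).
  apply: subset_card_le => t [Ut p0 q0].
  by have [n nP] := is_derive_isolated q0 (dphi t Ut) p0; exists n.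
apply: bigcup_countable => // n _; apply: (@countable_isolated _ n).
move=> s t [ps _] [_ Ht] st; apply: contrapT => /eqP s_t.
by have := Ht s s_t st; rewrite ps eqxx.
Qed.

Lemma is_derive_continuous_integral (F f : R -> R) (a b : R) : a < b ->
  (forall t, is_derive t 1 F (f t)) -> continuous f ->
  (\int[mu]_(t in `[a, b]) (f t)%:E = (F b - F a)%:E)%E.
Proof.
move=> ab dF cf.
have cF : continuous F by move=> t; exact: is_derive1_continuous.
rewrite (continuous_FTC2 (F := F) ab)//.
- by apply: continuous_subspaceT => t; exact: cf.
- split=> [t _||]; first by have [] := dF t.
    exact/cvg_at_right_filter/cF.
  exact/cvg_at_left_filter/cF.
- by move=> t _; rewrite derive1E; have [] := dF t.
Qed.

(** At a point outside U, |phi| < e on the nearby part of U, so the extension by 0 is locally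
    constant 0, whatever the shape of U. *)
Lemma is_derive_shrink_restrict U phi psi e : 0 < e -> open U ->
  (forall t, U t -> is_derive t 1 phi (psi t)) ->
  (forall t, ~ U t -> forall e, 0 < e -> \forall s \near t, U s -> `|phi s| < e) ->
  forall t, is_derive t 1 ((shrink e \o phi) \_ U)
    (((fun t => dshrink e (phi t) * psi t) \_ U) t).
Proof.
move=> e0 oU dphi van t; rewrite patchE; case: ifPn => [/set_mem Ut|/negP nU].
  have H := is_derive1_comp (is_derive_shrink (phi t) e0) (dphi t Ut).
  apply: near_eq_is_derive H; near=> s.
  rewrite patchE ifT//; apply/mem_set; near: s; exact: (open_nbhs_nbhs (conj oU Ut)).
apply: (near_eq_is_derive (f := cst 0)).
have {}nU : ~ U t by move=> Ut; apply: nU; exact: mem_set.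
apply: filterS (van t nU e e0) => s Hs.
rewrite patchE; case: ifPn => // /set_mem /Hs /ltW ps.
by rewrite /= shrink_small.
Unshelve. all: by end_near. Qed.

Lemma continuous_dshrink_restrict U phi psi e : 0 < e -> open U ->
  (forall t, U t -> {for t, continuous phi}) ->
  (forall t, U t -> {for t, continuous psi}) ->
  (forall t, ~ U t -> forall e, 0 < e -> \forall s \near t, U s -> `|phi s| < e) ->
  continuous ((fun t => dshrink e (phi t) * psi t) \_ U).
Proof.
move=> e0 oU cphi cpsi van t; rewrite /continuous_at patchE.
case: ifPn => [/set_mem Ut|/negP nU].
  have : dshrink e (phi s) * psi s @[s --> t] --> dshrink e (phi t) * psi t.
    apply: cvgM; last exact: cpsi.
    by apply: continuous_comp; [exact: cphi|exact: continuous_dshrink].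
  apply: cvg_trans; apply: near_eq_cvg; near=> s.
  rewrite patchE ifT//; apply/mem_set; near: s; exact: (open_nbhs_nbhs (conj oU Ut)).
have {}nU : ~ U t by move=> Ut; apply: nU; exact: mem_set.
have : cst (0 : R) s @[s --> t] --> (0 : R) by exact: cvg_cst.
apply: cvg_trans; apply: near_eq_cvg.
apply: filterS (van t nU e e0) => s Hs.
rewrite patchE; case: ifPn => // /set_mem /Hs /ltW ps.
by rewrite dshrink_small// mul0r.
Unshelve. all: by end_near. Qed.

(** The derivatives [h n] of the thresholded functions have integral 0 by the fundamental theorem on
    [-L, L], and they converge to psi almost everywhere under the bound 2 * M. *)
Lemma integral_derive_vanishing U phi psi (L M : R) : open U ->
  (forall t, U t -> `|t| < L) ->
  (forall t, U t -> is_derive t 1 phi (psi t)) ->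
  (forall t, U t -> {for t, continuous psi}) ->
  (forall t, U t -> `|psi t| <= M) ->
  (forall t, ~ U t -> forall e, 0 < e -> \forall s \near t, U s -> `|phi s| < e) ->
  (\int[mu]_(t in U) (psi t)%:E = 0)%E.
Proof.
move=> oU bU dphi cpsi bpsi van.
have [->|/set0P[t0 Ut0]] := eqVneq U set0; first by rewrite integral_set0.
have L0 : 0 < L by apply: le_lt_trans (bU _ Ut0).
have mU : measurable U by exact: open_measurable.
have ULL : U `<=` `[- L, L].
  by move=> t /bU; rewrite /= in_itv/= -ler_norml => /ltW.
have muU : (mu U < +oo)%E.
  apply: le_lt_trans (compact_finite_measure (segment_compact (a := -L) (b := L))).
  by apply: le_measure => //; rewrite inE.
have cphi t : U t -> {for t, continuous phi}.
  by move=> /dphi; exact: is_derive1_continuous.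
pose h n t := dshrink n.+1%:R^-1 (phi t) * psi t.
have n0 n : 0 < n.+1%:R^-1 :> R by rewrite invr_gt0.
have ch n : {in U, continuous (h n)}.
  move=> t /set_mem Ut; apply: cvgM; last exact: cpsi.
  by apply: continuous_comp; [exact: cphi|exact: continuous_dshrink].
have int0 n : (\int[mu]_(t in U) (h n t)%:E = 0)%E.
  have -> : U = `[- L, L] `&` U by rewrite setIidr.
  rewrite integral_mkcondr -[X in _ \_ X]/U.
  rewrite (_ : (_ \_ _) = EFin \o (h n \_ U)) ?restrict_EFin//.
  have LL : - L < L by rewrite gt0_cp// oppr_lt0.
  have -> := is_derive_continuous_integral LL
    (is_derive_shrink_restrict (n0 n) oU dphi van)
    (continuous_dshrink_restrict (n0 n) oU cphi cpsi van).
  (* The end points L and -L lie outside U because the bound on U is strict, so the primitive is 0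
     at both. *)
  rewrite !patchE !ifF ?subrr//; apply/negP => /set_mem/bU.
    by rewrite normrN gtr0_norm// ltxx.
  by rewrite gtr0_norm// ltxx.
pose N := [set t | [/\ U t, phi t = 0 & psi t != 0]].
have cN : countable N by exact: countable_nondegenerate_zeros.
have [] := @dominated_convergence _ _ _ mu U mU (fun n => EFin \o h n)
   (EFin \o psi) (cst (2 * M)%:E).
- move=> n; apply/measurable_EFinP; apply: open_continuous_measurable_fun => //.

- apply/measurable_EFinP; apply: open_continuous_measurable_fun => //.
  by move=> t /set_mem; exact: cpsi.
- exists N; split.
  + exact: countable_measurable.
  + exact: countable_lebesgue_measure0.
  move=> t; apply: contra_notP => nN Ut; apply: cvg_EFin; first exact: nearW.
  (* Off N a zero of phi is also a zero of psi, and there the sequence is constantly 0; elsewhere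
     the factor [dshrink] tends to 1. *)
  have [p0|p0] := eqVneq (phi t) 0.
    have q0 : psi t = 0 by apply: contrapT => /eqP q0; apply: nN.
    by rewrite /comp /h q0; under eq_fun do rewrite mulr0; exact: cvg_cst.
  rewrite -[X in _ --> X]mul1r; apply: cvgMl; exact: dshrink_cvg.
- apply: measurable_bounded_integrable => //.
  by exists `|2 * M|; split; rewrite ?num_real// => x /ltW Hx t _.
- apply: aeW => t n Ut; rewrite lee_fin normrM.
  by apply: ler_pM => //; [exact: dshrink_bound|exact: bpsi].
move=> _ _; rewrite (_ : [sequence _]_n = cst 0%E); last first.
  by apply/funext => n; exact: int0.
by move=> /cvg_lim <-//; rewrite lim_cst.
Qed.

End one_dim.

(** * Integration over bounded open sets of R^3 *)

Section iterated_integral.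
Context d1 d2 (T1 : measurableType d1) (T2 : measurableType d2) (R : realType).
Variables (m1 : {sigma_finite_measure set T1 -> \bar R})
  (m2 : {sigma_finite_measure set T2 -> \bar R}).
Variable F : T1 * T2 -> \bar R.
Hypothesis iF : (m1 \x m2)%E.-integrable setT F.

Lemma integral_prod_eq0_snd :
  (forall x, \int[m2]_z F (x, z) = 0)%E -> (\int[m1 \x m2]_p F p = 0)%E.
Proof.
move=> H; rewrite -integral12_prod_meas1//.
by apply: integral0_eq => x _; exact: H.
Qed.

Lemma integral_prod_eq0_fst :
  (forall z, \int[m1]_x F (x, z) = 0)%E -> (\int[m1 \x m2]_p F p = 0)%E.
Proof.
move=> H; rewrite -integral21_prod_meas1//.
by apply: integral0_eq => x _; exact: H.
Qed.

End iterated_integral.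

Section mu2.
Context {R : realType}.
Local Notation mu := (@lebesgue_measure R).
Local Notation RT := (measurableTypeR R).

(* The library's canonical sigma-finite structure on a product measure is only
   found for finite measures, so [mu \x mu] gets its own name and instance. *)
Definition mu2 : set (RT * RT) -> \bar R := (mu \x mu)%E.

HB.instance Definition _ := Measure.on mu2.

Lemma mu2_sigma_finite : sigma_finite setT mu2.
Proof.
pose J (n : nat) : set R := `[- n%:R, n%:R]%classic.
have mJ n : measurable (J n : set RT) by exact: measurable_itv.
exists (fun n => J n `*` J n) => [|n].
  apply/esym/seteqP; split => // -[x y] _.
  exists (Num.bound (`|x| + `|y|)) => //=; rewrite /J/= !in_itv/= -!ler_norml.
  have xy : 0 <= `|x| + `|y| by rewrite addr_ge0.
  have := archi_boundP xy => H.
  by split; apply/ltW; apply: le_lt_trans H; rewrite ?lerDl ?lerDr.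
split; first exact: measurableX.
have fJ : mu (J n) \is a fin_num.
  by rewrite ge0_fin_numE//; exact/compact_finite_measure/segment_compact.
rewrite -ge0_fin_numE; last exact: measure_ge0.
have := fin_numM fJ fJ; rewrite -(product_measure1E mu mu (mJ n) (mJ n)).
exact.
Qed.

HB.instance Definition _ := Measure_isSigmaFinite.Build _ _ _ mu2 mu2_sigma_finite.

End mu2.

Lemma integrable_bounded_support d (T : measurableType d) (R : realType)
    (m : {measure set T -> \bar R}) (A : set T) (g : T -> \bar R) (M : R) :
  measurable A -> (m A < +oo)%E -> measurable_fun setT g ->
  (forall x, (`|g x| <= M%:E)%E) -> (forall x, ~ A x -> g x = 0%E) ->
  m.-integrable setT g.
Proof.
move=> mA Aoo mg gM g0.
have -> : g = g \_ A.
  apply/funext => x; rewrite patchE; case: ifPn => // /negP nA.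
  by apply: g0 => Ax; apply: nA; exact/mem_set.
apply: (integrable_mkcond _ mA).1; apply/integrableP; split.
  exact: measurable_funTS.
apply: (le_lt_trans (integral_le_bound M%:E _ _ _ _)) => //.
- exact: measurable_funTS.
- by rewrite (le_trans _ (gM point)).
- by apply: aeW => x _; exact: gM.
- by rewrite lte_mul_pinfty// (le_trans _ (gM point)).
Qed.

(** * Measurability, integrability and iterated integrals in three coordinates *)

Section measure3.
Context {R : realType}.
Local Notation mu := (@lebesgue_measure R).
Local Notation RT := (measurableTypeR R).
Local Notation mu3 := ((mu \x mu) \x mu)%E.
Implicit Types (O : set (vec R)) (f : vec R -> R) (p : RT * RT * RT).

Definition vecp p : vec R := vec3 p.1.1 p.1.2 p.2.

Lemma vec3E (a b c : R) (i : 'I_3) :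
  vec3 a b c 0 i = if i == 0 then a else if i == 1 then b else c.
Proof. by rewrite mxE. Qed.

(** Links the topology of row vectors to the product sigma-algebra: an open set is the countable
    union of the cubes with rational centre and half-width 1 / (n + 1) that it contains. *)
Lemma measurable_vecp_preimage O : open O -> measurable (vecp @^-1` O).
Proof.
move=> oO.
pose I (q : rat) (d : R) : set R := `](ratr q - d), (ratr q + d)[%classic.
pose B (u : rat * rat * rat * nat) : set (RT * RT * RT) :=
  let d := u.2.+1%:R^-1 in (I u.1.1.1 d `*` I u.1.1.2 d) `*` I u.1.2 d.
pose F u := if `[< B u `<=` vecp @^-1` O >] then B u else set0.
have -> : vecp @^-1` O = \bigcup_u F u.
  apply/seteqP; split => [p Op|p [u _]]; last first.
    by rewrite /F; case: ifPn => // /asboolP; exact.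
  have [e /= e0 He] : nbhs_ball (vecp p) O.
    exact/nbhs_ballP/(open_nbhs_nbhs (conj oO Op)).
  (* Half of e, since two points of one cube differ in each coordinate by less than twice the
     half-width. *)
  have [n ne] : exists n : nat, n.+1%:R^-1 < e / 2.
    by apply: exists_inv_natS; rewrite divr_gt0.
  have n0 : 0 < n.+1%:R^-1 :> R by rewrite invr_gt0.
  have rat_near (d x : R) : 0 < d -> exists q : rat, I q d x.
    move=> d0; have [|q] := @rat_in_itvoo R (x - d) (x + d); first by lra.
    by rewrite in_itv/= => /andP[h1 h2]; exists q; rewrite /I/= in_itv/=; lra.
  have [q1 h1] := rat_near _ p.1.1 n0.
  have [q2 h2] := rat_near _ p.1.2 n0.
  have [q3 h3] := rat_near _ p.2 n0.
  have I_ball q d x y : d < e / 2 -> I q d x -> I q d y -> ball x e y.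
    rewrite /I /ball/= !in_itv/= => ? /andP[? ?] /andP[? ?].
    rewrite ltr_norml; lra.
  exists (q1, q2, q3, n) => //; rewrite /F ifT; first by [].
  apply/asboolP => p' [[/= h1' h2'] h3']; apply: He; split => // i j.
  by rewrite ord1 !vec3E; case: ifPn => _; [|case: ifPn => _];
    apply: (I_ball _ _ _ _ ne); eassumption.
apply: countable_bigcupT_measurable => [|u]; first exact: countableP.
rewrite /F; case: ifPn => // _.
by apply: measurableX; [apply: measurableX|]; exact: measurable_itv.
Qed.

Lemma measurable_fun_vecp O f : open O -> (forall x, O x -> {for x, continuous f}) ->
  measurable_fun (vecp @^-1` O) (f \o vecp).
Proof.
move=> oO cf; apply: (measurability _ (RGenOpens.measurableE R)).
move=> _ [_ [a [b ->] <-]].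
have -> : vecp @^-1` O `&` (f \o vecp) @^-1` `]a, b[%classic =
   vecp @^-1` (O `&` f @^-1` `]a, b[%classic) by [].
apply: measurable_vecp_preimage; rewrite openE => x [Ox fx].
apply: filterI; first exact: (open_nbhs_nbhs (conj oO Ox)).
apply: cf => //; apply: open_nbhs_nbhs; split => //; exact: interval_open.
Qed.

Lemma bounded_set_coord O : bounded_set O ->
  exists2 L : R, 0 < L & forall x, O x -> forall i, `|x 0 i| < L.
Proof.
(* [HM] applies only to numbers strictly above M, which uses up one unit; the second unit makes L
   strict. *)
move=> [M [Mr HM]]; exists (`|M| + 2) => [|x Ox i].
  by rewrite ltr_wpDl.
have M1 : M < `|M| + 1 by rewrite (le_lt_trans (ler_norm _))// ltrDl.
have xM : `|x| <= `|M| + 1 := HM _ M1 _ Ox.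
apply: (@le_lt_trans _ _ (`|M| + 1)); last by rewrite ltrD2l ltrDr.
apply: le_trans xM; rewrite [leRHS]/Num.Def.normr/= mx_normrE.
exact: (le_bigmax _ (fun ij => `|x ij.1 ij.2|) (0, i)).
Qed.

Definition cube1 (L : R) : set RT := `[- L, L]%classic.

Lemma measurable_cube1 L : measurable (cube1 L).
Proof. exact: measurable_itv. Qed.

Lemma cube1_fin_num L : mu (cube1 L) \is a fin_num.
Proof.
by rewrite ge0_fin_numE//; exact/compact_finite_measure/segment_compact.
Qed.

Lemma measurable_cube2 L : measurable (cube1 L `*` cube1 L).
Proof. by apply: measurableX; exact: measurable_cube1. Qed.

Lemma mu_cube2 L : ((mu \x mu) (cube1 L `*` cube1 L) < +oo)%E.
Proof.
have := fin_numM (cube1_fin_num L) (cube1_fin_num L).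
rewrite -(product_measure1E mu mu (measurable_cube1 L) (measurable_cube1 L)).
by move=> H; rewrite -ge0_fin_numE//; exact: measure_ge0.
Qed.

Lemma mu3_bounded O : open O -> bounded_set O -> (mu3 (vecp @^-1` O) < +oo)%E.
Proof.
move=> oO /bounded_set_coord[L L0 HL].
apply: (@le_lt_trans _ _ (mu3 ((cube1 L `*` cube1 L) `*` cube1 L))).
  apply: le_measure => //; rewrite ?inE//.
  - exact: measurable_vecp_preimage.
  - by apply: measurableX; [exact: measurable_cube2|exact: measurable_cube1].
  - move=> p /HL H; have := H 0; have := H 1; have := H 2%:R.
    by rewrite !vec3E/= /cube1 /= !in_itv/= -!ler_norml => /ltW ? /ltW ? /ltW ?.
rewrite product_measure1E//; [|exact: measurable_cube2|exact: measurable_cube1].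
apply: lte_mul_pinfty; [exact: measure_ge0| |by rewrite ltey_eq cube1_fin_num].
by rewrite ge0_fin_numE; [exact: mu_cube2|exact: measure_ge0].
Qed.

Definition bounded_on O f := exists M : R, forall x, O x -> `|f x| <= M.

Lemma integrable_vecp O f : open O -> bounded_set O ->
  (forall x, O x -> {for x, continuous f}) -> bounded_on O f ->
  mu3.-integrable (vecp @^-1` O) (EFin \o (f \o vecp)).
Proof.
move=> oO bO cf [M fM]; apply: measurable_bounded_integrable.
- exact: measurable_vecp_preimage.
- exact: mu3_bounded.
- exact: measurable_fun_vecp.
- exists M; split; first exact: num_real.
  by move=> y My p Op /=; apply: le_trans (fM _ Op) (ltW My).
Qed.

Lemma int3E O f : int3 O f = (\int[mu3]_(p in vecp @^-1` O) (f \o vecp) p)%R.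
Proof. by []. Qed.

Definition line (i : 'I_3) (x : vec R) (t : R) : vec R := x + t *: ebase i.

Lemma line_vec3 (a b c t : R) :
  [/\ line 0 (vec3 0 b c) t = vec3 t b c,
     line 1 (vec3 a 0 c) t = vec3 a t c &
     line 2%:R (vec3 a b 0) t = vec3 a b t].
Proof.
split; apply/rowP => j; rewrite !mxE; case: j => [[|[|[|//]]] ?] /=;
  by rewrite ?mulr1 ?mulr0 ?addr0 ?add0r.
Qed.

Section fubini3.
Variables (O : set (vec R)) (f : vec R -> R).
Hypotheses (oO : open O) (bO : bounded_set O)
  (cf : forall x, O x -> {for x, continuous f}) (bf : bounded_on O f).

Let E := vecp @^-1` O.
Let F : RT * RT * RT -> \bar R := (EFin \o (f \o vecp)) \_ E.

Let mE : measurable E. Proof. exact: measurable_vecp_preimage. Qed.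

Let iF : mu3.-integrable setT F.
Proof. apply: (integrable_mkcond _ mE).1; exact: integrable_vecp. Qed.

Let int3F : int3 O f = fine (\int[mu3]_p F p)%E.
Proof. by rewrite int3E /Rintegral integral_mkcond. Qed.

Let slice0 (V : R -> vec R) :
  (\int[mu]_(t in [set t | O (V t)]) (f (V t))%:E = 0)%E ->
  forall p : R -> R * R * R, (forall t, vecp (p t) = V t) ->
  (\int[mu]_t F (p t) = 0)%E.
Proof.
move=> H p pV; rewrite -[RHS]H [RHS]integral_mkcond; apply: eq_integral => t _.
rewrite /F !patchE; have [OV|OV] := pselect (O (V t)).
  by rewrite !ifT; [rewrite /= pV|exact: mem_set|apply/mem_set; rewrite /E/= pV].
rewrite !ifF//; apply/negbTE/negP => /set_mem //.
by rewrite /E/= pV.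
Qed.

Lemma int3_slice2_eq0 :
  (forall x y, \int[mu]_(t in [set t | O (vec3 x y t)]) (f (vec3 x y t))%:E = 0)%E ->
  int3 O f = 0.
Proof.
move=> H; rewrite int3F.
have -> // : (\int[mu3]_p F p = 0)%E.
apply: (@integral_prod_eq0_snd _ _ _ _ _ mu2 mu F iF) => -[x y].
by apply: (@slice0 (vec3 x y)); first exact: H.
Qed.

(** Fubini alone gives integrable slices for almost every z. Boundedness of f and of O gives it for
    every z, as a second exchange of integrals inside the slice requires. *)
Let iFz z : (mu \x mu)%E.-integrable setT (fun xy => F (xy, z)).
Proof.
have [L L0 HL] := bounded_set_coord bO; have [M HM] := bf.
apply: (@integrable_bounded_support _ _ _ _ (cube1 L `*` cube1 L) _ `|M|).
- exact: measurable_cube2.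
- exact: mu_cube2.
- by apply: measurable_fun_pair1; have /integrableP[] := iF.
- move=> p; rewrite /F patchE; case: ifPn => [/set_mem Op|_].
    by rewrite lee_fin/= (le_trans (HM _ Op)) ?ler_norm.
  by rewrite abse0 lee_fin.
- move=> -[x y] nJ; rewrite /F patchE ifF//; apply/negbTE/negP => /set_mem/= Op.
  apply: nJ; have H := HL _ Op; have := H 0; have := H 1.
  by rewrite !vec3E/= /cube1 /= !in_itv/= -!ler_norml => /ltW ? /ltW ?.
Qed.

Lemma int3_slice1_eq0 :
  (forall x z, \int[mu]_(t in [set t | O (vec3 x t z)]) (f (vec3 x t z))%:E = 0)%E ->
  int3 O f = 0.
Proof.
move=> H; rewrite int3F.
have -> // : (\int[mu3]_p F p = 0)%E.
apply: (@integral_prod_eq0_fst _ _ _ _ _ mu2 mu F iF) => z.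
apply: (@integral_prod_eq0_snd _ _ _ _ _ mu mu _ (iFz z)) => x.
by apply: (@slice0 (fun y => vec3 x y z)); first exact: H.
Qed.

Lemma int3_slice0_eq0 :
  (forall y z, \int[mu]_(t in [set t | O (vec3 t y z)]) (f (vec3 t y z))%:E = 0)%E ->
  int3 O f = 0.
Proof.
move=> H; rewrite int3F.
have -> // : (\int[mu3]_p F p = 0)%E.
apply: (@integral_prod_eq0_fst _ _ _ _ _ mu2 mu F iF) => z.
apply: (@integral_prod_eq0_fst _ _ _ _ _ mu mu _ (iFz z)) => y.
by apply: (@slice0 (fun x => vec3 x y z)); first exact: H.
Qed.

(** One order of integration for each direction i, with the integral along i innermost. The lines
    through points with i-th coordinate 0 are all the lines needed. *)
Lemma int3_slice_eq0 (i : 'I_3) :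
  (forall x, \int[mu]_(t in [set t | O (line i x t)]) (f (line i x t))%:E = 0)%E ->
  int3 O f = 0.
Proof.
have [->|[->|->]] : i = 0 \/ i = 1 \/ i = 2%:R.
  by case: i => [[|[|[|//]]] i3]; [left|right; left|right; right]; exact/val_inj.
- move=> H; apply: int3_slice0_eq0 => y z; move: (H (vec3 0 y z)).
  have -> // : line 0 (vec3 0 y z) = (fun t => vec3 t y z).
  by apply/funext => t; have [-> _ _] := line_vec3 0 y z t.
- move=> H; apply: int3_slice1_eq0 => x z; move: (H (vec3 x 0 z)).
  have -> // : line 1 (vec3 x 0 z) = (fun t => vec3 x t z).
  by apply/funext => t; have [_ -> _] := line_vec3 x 0 z t.
- move=> H; apply: int3_slice2_eq0 => x y; move: (H (vec3 x y 0)).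
  have -> // : line 2%:R (vec3 x y 0) = (fun t => vec3 x y t).
  by apply/funext => t; have [_ _ ->] := line_vec3 x y 0 t.
Qed.

End fubini3.

End measure3.

(** * Smooth fields and the divergence theorem *)

Section fields.
Context {R : realType}.
Variables (U Om : set (vec R)) (l : vec R).
Hypotheses (oU : open U) (OmU : Om `<=` U).
Implicit Types (f g : vec R -> R) (i : 'I_3).

Lemma near_open (A : set (vec R)) x : open A -> A x -> \forall y \near x, A y.
Proof. by move=> oA Ax; exact: (open_nbhs_nbhs (conj oA Ax)). Qed.

Lemma near_eq_open f g x : (forall x, U x -> f x = g x) -> U x ->
  \forall y \near x, f y = g y.
Proof. by move=> fg Ux; apply: filterS (near_open oU Ux) => y; exact: fg. Qed.

Lemma pd_eq f g x i : (forall x, U x -> f x = g x) -> U x -> pd i f x = pd i g x.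
Proof. by move=> fg Ux; apply: near_eq_derive; exact: near_eq_open. Qed.

(** Two sets, to serve both boundary conditions: U is the domain itself for Dirichlet data and the
    whole space for periodic data, while bounds and integrals concern Om. *)
Definition cont_bounded f : Prop :=
  (forall x, U x -> {for x, continuous f}) /\ bounded_on Om f.

Lemma cont_bounded_eq f g : (forall x, U x -> f x = g x) ->
  cont_bounded f -> cont_bounded g.
Proof.
move=> fg [cf [M bf]]; split=> [x Ux|].
  suff : g y @[y --> x] --> g x by [].
  rewrite -(fg x Ux); apply: cvg_trans (cf x Ux).
  by apply: (near_eq_cvg (F := nbhs x)); exact: near_eq_open.
by exists M => x Ox; rewrite -fg; [exact: bf|exact: OmU].
Qed.

Lemma cont_bounded_cst (c : R) : cont_bounded (fun=> c).
Proof. by split=> [x _|]; [exact: cst_continuous|exists `|c|]. Qed.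

Lemma cont_boundedD f g : cont_bounded f -> cont_bounded g ->
  cont_bounded (fun x => f x + g x).
Proof.
move=> [cf [M bf]] [cg [N bg]]; split=> [x Ux|].
  exact: (continuousD (cf x Ux) (cg x Ux)).
exists (M + N) => x Ox; rewrite (le_trans (ler_normD _ _))// lerD//.
  exact: bf.
exact: bg.
Qed.

Lemma cont_boundedM f g : cont_bounded f -> cont_bounded g ->
  cont_bounded (fun x => f x * g x).
Proof.
move=> [cf [M bf]] [cg [N bg]]; split=> [x Ux|].
  exact: (continuousM (cf x Ux) (cg x Ux)).
exists (M * N) => x Ox; rewrite normrM ler_pM//.
  exact: bf.
exact: bg.
Qed.

(** A form of [Ck] stated with [pd] itself instead of an auxiliary derivative, and with bounds on Om
    in place of continuity up to the boundary. *)
Fixpoint smooth k f : Prop :=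
  cont_bounded f /\
  if k is k'.+1 then
    forall i, (forall x, U x -> derivable f x (ebase i)) /\ smooth k' (pd i f)
  else True.

Lemma smooth0 k f : smooth k f -> cont_bounded f.
Proof. by case: k => [|k] []. Qed.

Lemma smooth_pd k f i : smooth k.+1 f -> smooth k (pd i f).
Proof. by case=> _ /(_ i)[]. Qed.

Lemma smooth_derivable k f i x : smooth k.+1 f -> U x -> derivable f x (ebase i).
Proof. by case=> _ /(_ i)[+ _]; exact. Qed.

Lemma smoothS k f : smooth k.+1 f -> smooth k f.
Proof.
elim: k f => [|k IH] f [cf df]; split => // i.
by have [d1 d2] := df i; split => //; exact: IH.
Qed.

Lemma smooth_eq k f g : (forall x, U x -> f x = g x) -> smooth k f -> smooth k g.
Proof.
elim: k f g => [|k IH] f g fg [cf df].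
  by split=> //; exact: cont_bounded_eq cf.
split=> [|i]; first exact: cont_bounded_eq cf.
have [d1 d2] := df i; split => [x Ux|].
  by apply: near_eq_derivable (d1 x Ux); exact: near_eq_open.
by apply: IH d2 => x Ux; exact: pd_eq.
Qed.

Lemma smooth_cst k (c : R) : smooth k (fun=> c).
Proof.
elim: k c => [|k IH] c; split => //; try exact: cont_bounded_cst.
move=> i; split=> [x _|]; first exact: derivable_cst.
by apply: smooth_eq (IH 0) => x _; rewrite /pd derive_cst.
Qed.

Lemma pdD i f g x : derivable f x (ebase i) -> derivable g x (ebase i) ->
  pd i (fun y => f y + g y) x = pd i f x + pd i g x.
Proof. by move=> df dg; rewrite /pd -deriveD. Qed.

Lemma pdM i f g x : derivable f x (ebase i) -> derivable g x (ebase i) ->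
  pd i (fun y => f y * g y) x = pd i f x * g x + f x * pd i g x.
Proof. move=> df dg; rewrite /pd -[fun y => _]/(f * g) (deriveM df dg) /GRing.scale /=.
by rewrite addrC mulrC. Qed.

Lemma smoothD k f g : smooth k f -> smooth k g -> smooth k (fun x => f x + g x).
Proof.
elim: k f g => [|k IH] f g sf sg;
  (split; first exact: (cont_boundedD (smooth0 sf) (smooth0 sg))).
  by [].
move=> i; split => [x Ux|].
  exact: (derivableD (smooth_derivable sf Ux) (smooth_derivable sg Ux)).
apply: (@smooth_eq _ (fun x => pd i f x + pd i g x)) => [x Ux|].
  by rewrite (pdD (smooth_derivable sf Ux) (smooth_derivable sg Ux)).
by apply: IH; exact: smooth_pd.
Qed.

Lemma smoothM k f g : smooth k f -> smooth k g -> smooth k (fun x => f x * g x).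
Proof.
elim: k f g => [|k IH] f g sf sg;
  (split; first exact: (cont_boundedM (smooth0 sf) (smooth0 sg))).
  by [].
move=> i; split => [x Ux|].
  exact: (derivableM (smooth_derivable sf Ux) (smooth_derivable sg Ux)).
apply: (@smooth_eq _ (fun x => pd i f x * g x + f x * pd i g x)) => [x Ux|].
  by rewrite (pdM (smooth_derivable sf Ux) (smooth_derivable sg Ux)).
by apply: smoothD; apply: IH; solve [exact: smooth_pd|exact: smoothS].
Qed.

(** The difference quotients at the two points are the same function, hence so are their limits. *)
Lemma periodic_pd f i : periodic_field l f -> periodic_field l (pd i f).
Proof.
move=> pf j x; rewrite /pd /derive;
set F := (X in X @ _); set G := (X in _ = lim (X @ _)).
suff -> : F = G by [].
by apply/funext => h; rewrite /F /G /= pf addrA pf.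
Qed.

End fields.

(** * Partial derivatives with zero integral *)

Section divergence.
Context {R : realType}.
Local Notation mu := (@lebesgue_measure R).
Implicit Types (U Om : set (vec R)) (f : vec R -> R) (i : 'I_3) (x l : vec R).

Lemma line_shift i x s t : line i x (s + t) = s *: ebase i + line i x t.
Proof. by rewrite /line scalerDl addrCA. Qed.

Lemma line_coord i x t : line i x t 0 i = x 0 i + t.
Proof. by rewrite !mxE !eqxx mulr1. Qed.

Lemma line_coord_neq i j x t : j != i -> line i x t 0 j = x 0 j.
Proof. by move=> ji; rewrite !mxE (negbTE ji) andbF mulr0 addr0. Qed.

Lemma continuous_line i x : continuous (line i x).
Proof.
move=> t; apply: cvgD; first exact: cvg_cst.
exact: scalel_continuous.
Qed.

Lemma is_derive_line f i x t : derivable f (line i x t) (ebase i) ->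
  is_derive t 1 (fun s => f (line i x s)) (pd i f (line i x t)).
Proof.
rewrite /pd /derivable /derive; set F := (X in X @ _) => cF.
pose G h := h^-1 *: (((fun s => f (line i x s)) \o shift t) (h *: 1) - f (line i x t)).
have GF : G = F.
  by apply/funext => h; rewrite /F /G /= [h *: 1]mulr1 line_shift.
by apply: DeriveDef; rewrite /derivable /derive -/G GF.
Qed.

(** The section of Om by a line is an arbitrary bounded open set of parameters, which is the setting
    of [integral_derive_vanishing]. *)
Lemma int3_pd_vanishing Om f i : open Om -> bounded_set Om ->
  smooth Om Om 1 f ->
  (forall x, ~ Om x -> forall e, 0 < e -> \forall y \near x, Om y -> `|f y| < e) ->
  int3 Om (pd i f) = 0.
Proof.
move=> oO bO sf van; have [cdf [M bdf]] := smooth0 (smooth_pd i sf).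
apply: (@int3_slice_eq0 _ _ _ oO bO cdf _ i); first by exists M.
move=> x; have [L L0 HL] := bounded_set_coord bO.
(* The parameter t is the i-th coordinate of the point minus that of x, whence the bound L +
   |x_i|. *)
apply: (@integral_derive_vanishing _ _ (fun t => f (line i x t)) _ (L + `|x 0 i|) M).
- rewrite (_ : [set _ | _] = line i x @^-1` Om)//.
  by apply: open_comp => // t _; exact: continuous_line.
- move=> t /= /HL /(_ i); rewrite line_coord => xt.
  rewrite -[t](addKr (x 0 i)) (le_lt_trans (ler_normD _ _))// normrN addrC.
  by rewrite ltrD2r.
- by move=> t Ot; apply: is_derive_line; exact: (smooth_derivable sf).
- move=> t Ot; apply: continuous_comp; first exact: continuous_line.
  exact: cdf.
- by move=> t Ot; exact: bdf.
- move=> t nO e e0; exact: (continuous_line (van _ nO e e0)).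
Qed.

Definition box (a b : vec R) : set (vec R) := [set x | forall i, a 0 i < x 0 i < b 0 i].

(** Each line meets the box in the empty set or in an interval of exactly one period, at whose ends
    f takes equal values. *)
Lemma int3_pd_periodic (a b : vec R) f i :
  (forall i, a 0 i < b 0 i) -> open (box a b) -> bounded_set (box a b) ->
  smooth setT (box a b) 1 f -> periodic_field (b - a) f ->
  int3 (box a b) (pd i f) = 0.
Proof.
move=> ab oO bO sf pf; have [cdf [M bdf]] := smooth0 (smooth_pd i sf).
have cT x : {for x, continuous (pd i f)} by exact: cdf.
apply: (@int3_slice_eq0 _ _ _ oO bO (fun x _ => cT x) _ i); first by exists M.
move=> x; have [H|H] := pselect (forall j, j != i -> a 0 j < x 0 j < b 0 j); last first.
  rewrite (_ : [set _ | _] = set0) ?integral_set0//.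
  apply/seteqP; split => // t /= Ot; apply: H => j ji.
  by have := Ot j; rewrite line_coord_neq.
rewrite (_ : [set _ | _] = `]a 0 i - x 0 i, b 0 i - x 0 i[%classic); last first.
  apply/seteqP; split => t /=.
    by move=> /(_ i); rewrite line_coord in_itv/= ltrBlDl ltrBrDl.
  rewrite in_itv/= ltrBlDl ltrBrDl => it j.
  by have [->|ji] := eqVneq j i; [rewrite line_coord|rewrite line_coord_neq//; exact: H].
have c : continuous (fun t => pd i f (line i x t)).
  by move=> t; apply: continuous_comp; [exact: continuous_line|exact: cT].
have d (t : R) : is_derive t 1 (fun t => f (line i x t)) (pd i f (line i x t)).
  by apply: is_derive_line; exact: (smooth_derivable sf).
have ab' : a 0 i - x 0 i < b 0 i - x 0 i by rewrite ltrD2r.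
have := is_derive_continuous_integral ab' d c.
have -> : line i x (b 0 i - x 0 i) =
    line i x (a 0 i - x 0 i) + (b - a) 0 i *: ebase i.
  rewrite [RHS]addrC -line_shift; congr (line i x _).
  rewrite [(b - a) 0 i]mxE [(- a) 0 i]mxE; ring.
rewrite pf subrr integral_itv_bndoo//.
by apply/measurable_EFinP; apply: open_continuous_measurable_fun.
Qed.

Lemma compact_closure_bounded Om : bounded_set Om -> compact (closure Om).
Proof.
move=> /bounded_set_coord[L L0 HL].
pose K := [set x : vec R | forall i, `[- L, L]%classic (x 0 i)].
have cK : closed K.
  have -> : K = \bigcap_i ((fun x : vec R => x 0 i) @^-1` `[- L, L]%classic).
    by apply/seteqP; split => x /= H i; [move=> _; exact: H|exact: (H i I)].
  apply: closed_bigI => i _; apply: closed_comp => [x _|].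
    exact: coord_continuous.
  exact: itv_closed.
apply: (@subclosed_compact _ _ K); first exact: closed_closure.
  by apply: (@rV_compact _ _ (fun=> `[- L, L]%classic)) => i; exact: segment_compact.
rewrite ((closure_id K).1 cK); apply: closure_subset => x Ox i /=.
by rewrite in_itv/= -ler_norml ltW ?HL.
Qed.

(** Boundedness comes from compactness of the closure of Om, on which f is continuous. *)
Lemma within_cont_bounded U Om f : open U -> Om `<=` U -> bounded_set Om ->
  {within closure U, continuous f} -> cont_bounded U Om f.
Proof.
move=> oU OU bO cf; split=> [x Ux|].
  have := continuous_subspaceW (@subset_closure _ U) cf.
  by rewrite continuous_open_subspace// => /(_ x); apply; exact/mem_set.
have := continuous_subspaceW (closure_subset OU) cf => cf'.
have [M [_ HM]] := compact_bounded
  (continuous_compact cf' (compact_closure_bounded bO)).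
exists (`|M| + 1) => x Ox; apply: HM.
  by rewrite (le_lt_trans (ler_norm _))// ltrDl.
by exists x => //; exact: subset_closure.
Qed.

Lemma Ck_smooth U Om k f : open U -> Om `<=` U -> bounded_set Om ->
  Ck U k f -> smooth U Om k f.
Proof.
move=> oU OU bO; elim: k f => [|k IH] f /= [cf df].
  by split=> //; exact: within_cont_bounded.
split=> [|i]; first exact: within_cont_bounded.
have [g dg sg] := df i; split=> [x Ux|]; first by have [] := dg x Ux.
by apply: smooth_eq (IH _ sg) => // x Ux; rewrite /pd; have [_ ->] := dg x Ux.
Qed.

End divergence.

(** * Vector algebra and integration of fields *)

Section vector_algebra.
Context {R : realType}.
Implicit Types (a b u w : vec R) (p q : 'M[R]_3).

Lemma sum3 (V : nmodType) (F : 'I_3 -> V) : \sum_i F i = F 0 + F 1 + F 2.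
Proof.
rewrite !big_ord_recl big_ord0 addr0 addrA.
by congr (F _ + F _ + F _); exact/val_inj.
Qed.

(** Stated as a product of equations so that [rewrite] takes it as a set of rules. *)
Lemma ord3_add : (((0 + 1 = 1 :> 'I_3)%R * (0 + 2 = 2 :> 'I_3)%R)
  * ((1 + 1 = 2 :> 'I_3)%R * (1 + 2 = 0 :> 'I_3)%R)
  * ((2 + 1 = 0 :> 'I_3)%R * (2 + 2 = 1 :> 'I_3)%R))%type.
Proof. by do !split; exact/val_inj. Qed.

Lemma forall_ord3 (T : 'I_3 -> Prop) : T 0 -> T 1 -> T 2 -> forall i, T i.
Proof.
move=> T0 T1 T2 [[|[|[|//]]] i3].
- by rewrite (_ : Ordinal i3 = 0)//; exact/val_inj.
- by rewrite (_ : Ordinal i3 = 1)//; exact/val_inj.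
- by rewrite (_ : Ordinal i3 = 2)//; exact/val_inj.
Qed.

Lemma dotvE u w : dotv u w = u 0 0 * w 0 0 + u 0 1 * w 0 1 + u 0 2 * w 0 2.
Proof. by rewrite /dotv sum3. Qed.

Lemma crossvE u w : crossv u w = vec3
  (u 0 1 * w 0 2 - u 0 2 * w 0 1) (u 0 2 * w 0 0 - u 0 0 * w 0 2)
  (u 0 0 * w 0 1 - u 0 1 * w 0 0).
Proof. by apply/rowP; apply: forall_ord3; rewrite !mxE !ord3_add. Qed.

Lemma vec3_coord (x y z : R) :
  (vec3 x y z 0 0 = x) * (vec3 x y z 0 1 = y) * (vec3 x y z 0 2 = z).
Proof. by rewrite !mxE. Qed.

Lemma dotvC u w : dotv u w = dotv w u.
Proof. by rewrite !dotvE; ring. Qed.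

Lemma dotvv_ge0 u : 0 <= dotv u u.
Proof. by apply: sumr_ge0 => i _; rewrite -expr2 sqr_ge0. Qed.

Lemma enorm_sqr u : enorm u ^+ 2 = dotv u u.
Proof. by rewrite /enorm sqr_sqrtr ?dotvv_ge0. Qed.

(** The map b |-> (u x b) x u is b |-> |u|^2 b - (u . b) u, which is symmetric. *)
Lemma dot_double_cross u a b :
  dotv a (crossv (crossv u b) u) = dotv b (crossv (crossv u a) u).
Proof. by rewrite !crossvE !dotvE !vec3_coord; ring. Qed.

Lemma dot_double_cross_self u a :
  dotv a (crossv (crossv u a) u) = dotv (crossv u a) (crossv u a).
Proof. by rewrite !crossvE !dotvE !vec3_coord; ring. Qed.

Lemma dot_cross_self u a : dotv u (crossv a u) = 0.
Proof. by rewrite !crossvE !dotvE !vec3_coord; ring. Qed.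

Lemma ddot_ge0 p : 0 <= ddot p p.
Proof. by apply: sumr_ge0 => i _; apply: sumr_ge0 => j _; rewrite -expr2 sqr_ge0. Qed.

End vector_algebra.

Section integration.
Context {R : realType}.
Variables (U Om : set (vec R)).
Hypotheses (oO : open Om) (bO : bounded_set Om) (OU : Om `<=` U).
Implicit Types (f g : vec R -> R).

Let integrable_cb f : cont_bounded U Om f ->
  (((@lebesgue_measure R \x @lebesgue_measure R) \x @lebesgue_measure R)%E).-integrable
  (vecp @^-1` Om) (EFin \o (f \o vecp)).
Proof. by case=> cf bf; apply: integrable_vecp => // x /OU; exact: cf. Qed.

Lemma int3D f g : cont_bounded U Om f -> cont_bounded U Om g ->
  int3 Om (fun x => f x + g x) = int3 Om f + int3 Om g.
Proof.
move=> cf cg; rewrite !int3E -RintegralD//; first exact: measurable_vecp_preimage.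
  exact: integrable_cb.
exact: integrable_cb.
Qed.

Lemma int3Z (r : R) f : cont_bounded U Om f ->
  int3 Om (fun x => r * f x) = r * int3 Om f.
Proof.
move=> cf; rewrite !int3E -RintegralZl//; first exact: measurable_vecp_preimage.
exact: integrable_cb.
Qed.

Lemma le_int3 f g : cont_bounded U Om f -> cont_bounded U Om g ->
  (forall x, Om x -> f x <= g x) -> int3 Om f <= int3 Om g.
Proof.
move=> cf cg fg; rewrite !int3E le_Rintegral//; first exact: measurable_vecp_preimage.
- exact: integrable_cb.
- exact: integrable_cb.
- by move=> p Op; exact: fg.
Qed.

Lemma int3_ge0 f : (forall x, Om x -> 0 <= f x) -> 0 <= int3 Om f.
Proof. by move=> f0; rewrite int3E; apply: Rintegral_ge0 => p Op; exact: f0. Qed.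

(** Integrability is carried along with the zero integral, so that this class is closed under linear
    combinations. *)
Definition null f := cont_bounded U Om f /\ int3 Om f = 0.

Lemma nullD f g : null f -> null g -> null (fun x => f x + g x).
Proof.
move=> [cf f0] [cg g0]; split; first exact: cont_boundedD.
by rewrite int3D// f0 g0 addr0.
Qed.

Lemma nullZ (r : R) f : null f -> null (fun x => r * f x).
Proof.
move=> [cf f0]; split; first exact: cont_boundedM (cont_bounded_cst _ _ r) cf.
by rewrite int3Z// f0 mulr0.
Qed.

Lemma null_sum n (F : 'I_n -> vec R -> R) : (forall i, null (F i)) ->
  null (fun x => \sum_i F i x).
Proof.
elim: n F => [|n IH] F HF.
  under eq_fun do rewrite big_ord0; split; first exact: cont_bounded_cst.
  by rewrite int3E Rintegral_cst ?mul0r//; exact: measurable_vecp_preimage.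
by under eq_fun do rewrite big_ord_recr; apply: nullD => //; exact: IH.
Qed.

End integration.

(** * Regularity of the fields of the scheme, and product rules *)

Section regular_fields.
Context {R : realType}.
Variables (U Om : set (vec R)) (l : vec R).
Hypotheses (oU : open U) (OU : Om `<=` U).
Implicit Types (f g : vec R -> R) (u v w : vec R -> vec R)
  (s : vec R -> 'M[R]_3) (k : nat) (i j : 'I_3).

(* With [l = 0] periodicity is void: this is the class used for Dirichlet conditions. *)
Definition reg k f := smooth U Om k f /\ periodic_field l f.
Definition regv k v := forall j, reg k (fun x => v x 0 j).
Definition regm k s := forall i j, reg k (fun x => s x i j).

Lemma reg_cst k (r : R) : reg k (fun=> r).
Proof. by split; [exact: smooth_cst|]. Qed.

Lemma regD k f g : reg k f -> reg k g -> reg k (fun x => f x + g x).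
Proof.
move=> [sf pf] [sg pg]; split; first exact: smoothD.
by move=> i x; rewrite pf pg.
Qed.

Lemma regM k f g : reg k f -> reg k g -> reg k (fun x => f x * g x).
Proof.
move=> [sf pf] [sg pg]; split; first exact: smoothM.
by move=> i x; rewrite pf pg.
Qed.

Lemma regZ k (r : R) f : reg k f -> reg k (fun x => r * f x).
Proof. exact: regM (reg_cst k r). Qed.

Lemma regN k f : reg k f -> reg k (fun x => - f x).
Proof. by under eq_fun do rewrite -mulN1r; exact: regZ. Qed.

Lemma regB k f g : reg k f -> reg k g -> reg k (fun x => f x - g x).
Proof. by move=> rf /regN; exact: regD. Qed.

Lemma reg_pd k f i : reg k.+1 f -> reg k (pd i f).
Proof. by move=> [sf pf]; split; [exact: smooth_pd|exact: periodic_pd]. Qed.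

Lemma regS k f : reg k.+1 f -> reg k f.
Proof. by move=> [sf pf]; split; [exact: smoothS|]. Qed.

Lemma reg_sum k n (F : 'I_n -> vec R -> R) : (forall m, reg k (F m)) ->
  reg k (fun x => \sum_m F m x).
Proof.
elim: n F => [|n IH] F HF; first by under eq_fun do rewrite big_ord0; exact: reg_cst.
by under eq_fun do rewrite big_ord_recr; apply: regD => //; exact: IH.
Qed.

Lemma reg_cont k f : reg k f -> cont_bounded U Om f.
Proof. by case=> /smooth0. Qed.

Lemma reg_derivable k f x i : reg k.+1 f -> U x -> derivable f x (ebase i).
Proof. by case=> /smooth_derivable H _; exact: H. Qed.

Lemma regvS k v : regv k.+1 v -> regv k v.
Proof. by move=> rv j; exact: regS. Qed.

Lemma regvD k u v : regv k u -> regv k v -> regv k (fun x => u x + v x).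
Proof. by move=> ru rv j; under eq_fun do rewrite mxE; exact: regD. Qed.

Lemma regvN k v : regv k v -> regv k (fun x => - v x).
Proof. by move=> rv j; under eq_fun do rewrite mxE; exact: regN. Qed.

Lemma regvB k u v : regv k u -> regv k v -> regv k (fun x => u x - v x).
Proof. by move=> ru /regvN; exact: regvD. Qed.

Lemma regvM k f v : reg k f -> regv k v -> regv k (fun x => f x *: v x).
Proof. by move=> rf rv j; under eq_fun do rewrite mxE; exact: regM. Qed.

Lemma regvZ k (r : R) v : regv k v -> regv k (fun x => r *: v x).
Proof. exact: regvM (reg_cst k r). Qed.

Lemma regv_mid k u v : regv k u -> regv k v -> regv k (mid u v).
Proof. by move=> ru rv; apply: regvZ; exact: regvD. Qed.

Lemma reg_mid k f g : reg k f -> reg k g -> reg k (mid (V := R^o) f g).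
Proof. by move=> rf rg; apply: regZ; exact: regD. Qed.

Lemma reg_dotv k u v : regv k u -> regv k v -> reg k (fun x => dotv (u x) (v x)).
Proof. by move=> ru rv; apply: reg_sum => i; exact: regM. Qed.

Lemma regv_crossv k u v : regv k u -> regv k v -> regv k (fun x => crossv (u x) (v x)).
Proof.
by move=> ru rv j; under eq_fun do rewrite mxE; apply: regB; exact: regM.
Qed.

Lemma regv_grad k f : reg k.+1 f -> regv k (grad f).
Proof. by move=> rf j; under eq_fun do rewrite mxE; exact: reg_pd. Qed.

Lemma regv_curl k v : regv k.+1 v -> regv k (curl v).
Proof. by move=> rv j; under eq_fun do rewrite mxE; apply: regB; exact: reg_pd. Qed.

Lemma reg_divv k v : regv k.+1 v -> reg k (divv v).
Proof. by move=> rv; apply: reg_sum => i; exact: reg_pd. Qed.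

Lemma regm_gradv k v : regv k.+1 v -> regm k (gradv v).
Proof. by move=> rv i j; under eq_fun do rewrite mxE; exact: reg_pd. Qed.

Lemma regmD k s t : regm k s -> regm k t -> regm k (fun x => s x + t x).
Proof. by move=> rs rt i j; under eq_fun do rewrite mxE; exact: regD. Qed.

Lemma regmM k f s : reg k f -> regm k s -> regm k (fun x => f x *: s x).
Proof. by move=> rf rs i j; under eq_fun do rewrite mxE; exact: regM. Qed.

Lemma regmN k s : regm k s -> regm k (fun x => - s x).
Proof. by move=> rs i j; under eq_fun do rewrite mxE; exact: regN. Qed.

Lemma regm_tr k s : regm k s -> regm k (fun x => (s x)^T).
Proof. by move=> rs i j; under eq_fun do rewrite mxE; exact: rs. Qed.

Lemma regm_tensv k u v : regv k u -> regv k v -> regm k (fun x => tensv (u x) (v x)).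
Proof. by move=> ru rv i j; under eq_fun do rewrite mxE; exact: regM. Qed.

Lemma reg_ddot k s t : regm k s -> regm k t -> reg k (fun x => ddot (s x) (t x)).
Proof. by move=> rs rt; do 2 apply: reg_sum => ?; exact: regM. Qed.

Lemma regv_mulmv k s v : regm k s -> regv k v -> regv k (fun x => mulmv (s x) (v x)).
Proof.
by move=> rs rv i; under eq_fun do rewrite mxE; apply: reg_sum => j; exact: regM.
Qed.

Lemma regm_strain k v : regv k.+1 v -> regm k (strain v).
Proof.
move=> rv; apply: (regmM (reg_cst k _)); apply: regmD; first exact: regm_gradv.
by apply: regm_tr; exact: regm_gradv.
Qed.

Section scheme_fields.
Variables (c : material R) (v0 v1 n0 n1 : vec R -> vec R).
Hypotheses (rn0 : regv 3 n0) (rn1 : regv 3 n1) (rv0 : regv 2 v0) (rv1 : regv 2 v1).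

Lemma reg_beta n : regv 3 n -> reg 2 (beta n).
Proof. by move=> rn; apply: reg_dotv; [exact: regvS|exact: regv_curl]. Qed.

Lemma regv_omega n : regv 3 n -> regv 2 (omega n).
Proof. by move=> rn; apply: regv_crossv; [exact: regvS|exact: regv_curl]. Qed.

Lemma reg_oseen_frank_density n : regv 3 n ->
  reg 2 (fun x => kap1 c * divv n x ^+ 2 + kap2 c * beta n x ^+ 2
    + kap3 c * enorm (omega n x) ^+ 2).
Proof.
move=> rn; apply: regD; first apply: regD; apply: regZ.
- by under eq_fun do rewrite expr2; apply: regM; exact: reg_divv.
- by under eq_fun do rewrite expr2; apply: regM; exact: reg_beta.
- by under eq_fun do rewrite enorm_sqr; apply: reg_dotv; exact: regv_omega.
Qed.

(** Of the three derivatives of the director two are consumed here; the last one is spent on the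
    divergence of the stress. *)
Lemma regv_discrete_gradient : regv 1 (discrete_gradient c n0 n1).
Proof.
have rnh := regv_mid rn0 rn1.
have rb := reg_mid (reg_beta rn0) (reg_beta rn1).
have ro := regv_mid (regv_omega rn0) (regv_omega rn1).
apply: regvD; first apply: regvD.
- by apply: regvN; apply: regvZ; apply: regv_grad; exact: reg_divv.
- apply: regvZ; apply: regvD.
    exact: (regvM (regS rb) (regvS (regv_curl rnh))).
  exact: (regv_curl (regvM rb (regvS rnh))).
- apply: regvZ; apply: regvD.
    exact: (regv_crossv (regvS (regv_curl rnh)) (regvS ro)).
  exact: (regv_curl (regv_crossv ro (regvS rnh))).
Qed.

Lemma regv_qfield : regv 1 (qfield c n0 n1).
Proof.
have rnh : regv 1 (mid n0 n1) := regvS (regvS (regv_mid rn0 rn1)).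
exact: (regv_crossv (regv_crossv rnh regv_discrete_gradient) rnh).
Qed.

Lemma regm_leslie_stress : regm 1 (leslie_stress c v0 v1 n0 n1).
Proof.
have rnh : regv 1 (mid n0 n1) := regvS (regvS (regv_mid rn0 rn1)).
have rt : regm 1 (strain (mid v0 v1)) := regm_strain (regv_mid rv0 rv1).
have rq := regv_qfield; have rtn := regv_mulmv rt rnh.
have rnn := regm_tensv rnh rnh.
apply: regmD; first apply: regmD; first apply: regmD; first apply: regmD.
- exact: (regmM (regZ _ (reg_ddot rnn rt)) rnn).
- exact: (regmN (regmM (reg_cst 1 _) (regm_tensv rnh rq))).
- exact: (regmN (regmM (reg_cst 1 _) (regm_tensv rq rnh))).
- exact: (regmM (reg_cst 1 _) rt).
- exact: (regmM (reg_cst 1 _) (regmD (regm_tensv rnh rtn) (regm_tensv rtn rnh))).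
Qed.

End scheme_fields.

Section product_rules.
Variable x : vec R.
Hypothesis Ux : U x.

Lemma pdM_reg f g i : reg 1 f -> reg 1 g ->
  pd i (fun y => f y * g y) x = pd i f x * g x + f x * pd i g x.
Proof. by move=> rf rg; rewrite pdM//; apply: reg_derivable Ux; eassumption. Qed.

Lemma pdD_reg f g i : reg 1 f -> reg 1 g ->
  pd i (fun y => f y + g y) x = pd i f x + pd i g x.
Proof. by move=> rf rg; rewrite pdD//; apply: reg_derivable Ux; eassumption. Qed.

Lemma pdZ_reg (r : R) f i : reg 1 f -> pd i (fun y => r * f y) x = r * pd i f x.
Proof.
move=> rf; rewrite (pdM_reg _ (reg_cst 1 r) rf).
by rewrite {1}/pd derive_cst mul0r add0r.
Qed.

Lemma pdB_reg f g i : reg 1 f -> reg 1 g ->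
  pd i (fun y => f y - g y) x = pd i f x - pd i g x.
Proof.
move=> rf rg; under [X in pd i X _]eq_fun do rewrite -mulN1r.
by rewrite pdD_reg// ?pdZ_reg// ?mulN1r//; exact: regZ.
Qed.

Lemma sum_pd_scale w f : regv 1 w -> reg 1 f ->
  \sum_i pd i (fun y => w y 0 i * f y) x = divv w x * f x + dotv (w x) (grad f x).
Proof.
move=> rw rf; rewrite /divv /dotv mulr_suml -big_split; apply: eq_bigr => i _ /=.
by rewrite pdM_reg// mxE.
Qed.

Lemma pdM_coord v w i j (k : 'I_3) : regv 1 v -> regv 1 w ->
  pd i (fun y => v y 0 j * w y 0 k) x
  = gradv v x i j * w x 0 k + v x 0 j * gradv w x i k.
Proof. by move=> rv rw; rewrite pdM_reg// !mxE. Qed.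

Lemma curl_gradv v i :
  curl v x 0 i = gradv v x (i + 1) (i + 2) - gradv v x (i + 2) (i + 1).
Proof. by rewrite !mxE. Qed.

(** The identity div (w x b) = b . curl w - w . curl b, with the cross product expanded so that
    every term is the derivative of a product with one component of w. *)
Lemma sum_pd_cross w b : regv 1 w -> regv 1 b ->
  \sum_i (pd i (fun y => w y 0 (i + 1) * b y 0 (i + 2)) x
          - pd i (fun y => w y 0 (i + 2) * b y 0 (i + 1)) x)
  = dotv (b x) (curl w x) - dotv (w x) (curl b x).
Proof.
move=> rw rb; under eq_bigr => i _ do rewrite !pdM_coord//.
rewrite !sum3 !dotvE !curl_gradv !ord3_add.
by move: (gradv w x) (gradv b x) (w x) (b x) => Gw Gb W B; ring.
Qed.

(** Divergence of the vector with components s_ij v_j: the work of the stress on v splits off the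
    stress power s : grad v. *)
Lemma sum_pd_stress v s : regv 1 v -> regm 1 s ->
  \sum_i \sum_j pd i (fun y => v y 0 j * s y i j) x
  = dotv (v x) (divm s x) + ddot (s x) (gradv v x).
Proof.
move=> rv rs; under eq_bigr => i _ do under eq_bigr => j _ do rewrite pdM_reg//.
under eq_bigr => i _ do rewrite big_split.
rewrite big_split [LHS]addrC; congr (_ + _).
  rewrite exchange_big; apply: eq_bigr => j _.
  by rewrite mxE mulr_sumr.
by apply: eq_bigr => i _; apply: eq_bigr => j _; rewrite mxE mulrC.
Qed.

Lemma sum_pd_laplacian v : regv 2 v ->
  \sum_i \sum_j pd i (fun y => v y 0 j * pd i (fun z => v z 0 j) y) x
  = dotv (v x) (laplv v x) + ddot (gradv v x) (gradv v x).
Proof.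
move=> rv; have r1 := regvS rv.
have rp i j : reg 1 (pd i (fun z => v z 0 j)) by exact: reg_pd.
under eq_bigr => i _ do under eq_bigr => j _ do rewrite pdM_reg//.
under eq_bigr => i _ do rewrite big_split.
rewrite big_split [LHS]addrC; congr (_ + _).
  rewrite exchange_big; apply: eq_bigr => j _.
  by rewrite mxE mulr_sumr.
by apply: eq_bigr => i _; apply: eq_bigr => j _; rewrite mxE.
Qed.

Lemma divv_mid u v : regv 1 u -> regv 1 v ->
  divv (mid u v) x = 2^-1 * (divv v x + divv u x).
Proof.
move=> ru rv; rewrite /divv -big_split mulr_sumr; apply: eq_bigr => i _ /=.
rewrite -pdD_reg// -pdZ_reg; last exact: regD.
by congr (pd i _ x); apply/funext => y; rewrite !mxE.
Qed.

Lemma curl_mid u v : regv 1 u -> regv 1 v ->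
  curl (mid u v) x = 2^-1 *: (curl v x + curl u x).
Proof.
move=> ru rv.
have H i j : pd i (fun y => mid u v y 0 j) x =
    2^-1 * (pd i (fun y => v y 0 j) x + pd i (fun y => u y 0 j) x).
  rewrite -pdD_reg// -pdZ_reg; last exact: regD.
  by congr (pd i _ x); apply/funext => y; rewrite !mxE.
by apply/rowP => i; rewrite !mxE !H; ring.
Qed.

Lemma divv_sub u v : regv 1 u -> regv 1 v ->
  divv (fun y => v y - u y) x = divv v x - divv u x.
Proof.
move=> ru rv; rewrite /divv -sumrB; apply: eq_bigr => i _ /=.
rewrite -pdB_reg//.
by congr (pd i _ x); apply/funext => y; rewrite !mxE.
Qed.

Lemma curl_sub u v : regv 1 u -> regv 1 v ->
  curl (fun y => v y - u y) x = curl v x - curl u x.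
Proof.
move=> ru rv.
have H i j : pd i (fun y => (v y - u y) 0 j) x =
    pd i (fun y => v y 0 j) x - pd i (fun y => u y 0 j) x.
  rewrite -pdB_reg//.
  by congr (pd i _ x); apply/funext => y; rewrite !mxE.
by apply/rowP => i; rewrite !mxE !H; ring.
Qed.

End product_rules.

End regular_fields.

(** * The energy balance of one time step *)

Section energy_algebra.
Context {R : realType}.
Implicit Types (u w n q d : vec R) (p G : 'M[R]_3) (a b : vec R).

Lemma dotvDl u1 u2 w : dotv (u1 + u2) w = dotv u1 w + dotv u2 w.
Proof. by rewrite !dotvE !mxE; ring. Qed.

Lemma dotvDr u w1 w2 : dotv u (w1 + w2) = dotv u w1 + dotv u w2.
Proof. by rewrite !dotvE !mxE; ring. Qed.

Lemma dotvNr u w : dotv u (- w) = - dotv u w.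
Proof. by rewrite !dotvE !mxE; ring. Qed.

Lemma dotvZl (r : R) u w : dotv (r *: u) w = r * dotv u w.
Proof. by rewrite !dotvE !mxE; ring. Qed.

Lemma dotvZr (r : R) u w : dotv u (r *: w) = r * dotv u w.
Proof. by rewrite !dotvE !mxE; ring. Qed.

Lemma dotv_mulmv u G w : dotv u (mulmv G w) = dotv (u *m G) w.
Proof. by rewrite !dotvE !mxE !sum3; ring. Qed.

(** The midpoint rule is exact for squares. It serves the unit length, the kinetic energy and the
    bend term. *)
Lemma dotv_midpoint u0 u1 :
  dotv (2^-1 *: (u1 + u0)) (u1 - u0) = 2^-1 * (dotv u1 u1 - dotv u0 u0).
Proof. by rewrite !dotvE !mxE; field. Qed.

(** Pointwise counterpart of [strain], as [skewpart] is of [spin]: both depend on the gradient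
    matrix only. *)
Definition sympart G : 'M[R]_3 := 2^-1 *: (G + G^T).
Definition skewpart G : 'M[R]_3 := 2^-1 *: (G - G^T).

Lemma dot_mulmv_split a b G :
  dotv a (mulmv G b) = dotv a (mulmv (sympart G) b) + dotv a (mulmv (skewpart G) b).
Proof. by rewrite !dotvE !mxE !sum3 !mxE; field. Qed.

Lemma dot_mulmv_sym a b G :
  dotv a (mulmv (sympart G) b) = dotv b (mulmv (sympart G) a).
Proof. by rewrite !dotvE !mxE !sum3 !mxE; ring. Qed.

Lemma dot_mulmv_skew a b G :
  dotv a (mulmv (skewpart G) b) = - dotv b (mulmv (skewpart G) a).
Proof. by rewrite !dotvE !mxE !sum3 !mxE; ring. Qed.

Lemma ddotDl p (q : 'M[R]_3) G : ddot (p + q) G = ddot p G + ddot q G.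
Proof. by rewrite /ddot !sum3 !mxE; ring. Qed.

Lemma ddotNl p G : ddot (- p) G = - ddot p G.
Proof. by rewrite /ddot !sum3 !mxE; ring. Qed.

Lemma ddotZl (r : R) p G : ddot (r *: p) G = r * ddot p G.
Proof. by rewrite /ddot !sum3 !mxE; ring. Qed.

Lemma ddot_tensv a b G : ddot (tensv a b) G = dotv a (mulmv G b).
Proof. by rewrite /ddot !dotvE !mxE !sum3 !mxE; ring. Qed.

Lemma ddot_sympart G : ddot (sympart G) G = ddot (sympart G) (sympart G).
Proof. by rewrite /ddot !sum3 !mxE; field. Qed.

(** The power of a tensor a (x) b is a . (G b). Exchanging n and q keeps the sign of the symmetric
    part and flips that of the skew part, which yields s2 + s3 and s2 - s3. *)
Lemma ddot_leslie (s1 s2 s3 s4 s5 : R) n q G :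
  let t := sympart G in
  ddot ((s1 * ddot (tensv n n) t) *: tensv n n - s2 *: tensv n q - s3 *: tensv q n
    + s4 *: t + s5 *: (tensv n (mulmv t n) + tensv (mulmv t n) n)) G
  = s1 * dotv n (mulmv t n) ^+ 2 - (s2 + s3) * dotv q (mulmv t n)
    + (s2 - s3) * dotv q (mulmv (skewpart G) n) + s4 * ddot t t
    + 2 * s5 * dotv (mulmv t n) (mulmv t n).
Proof.
move=> /=.
have skew0 : dotv n (mulmv (skewpart G) n) = 0.
  by have := dot_mulmv_skew n n G; lra.
have tG := ddot_sympart G; move: skew0 tG.
(* The rules are specialised to G so that its two parts can then be replaced by opaque matrices. *)
have := fun a b => dot_mulmv_split a b G; have := fun a b => dot_mulmv_sym a b G.
have := fun a b => dot_mulmv_skew a b G.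
move: (sympart G) (skewpart G) => t o skew sym split skew0 tG.
rewrite !(ddotDl, ddotNl, ddotZl, ddot_tensv) tG !split skew0.
rewrite (skew n q) (sym n q) (skew n) (sym n (mulmv _ _)); ring.
Qed.

(** The discrete Leibniz rule, exact with midpoint averages for any bilinear product. *)
Lemma dotv_increment n0 n1 c0 c1 :
  dotv n1 c1 - dotv n0 c0
  = dotv (2^-1 *: (n1 + n0)) (c1 - c0) + dotv (n1 - n0) (2^-1 *: (c1 + c0)).
Proof. by rewrite !dotvE !mxE; field. Qed.

Lemma crossv_increment n0 n1 c0 c1 :
  crossv n1 c1 - crossv n0 c0
  = crossv (2^-1 *: (n1 + n0)) (c1 - c0) + crossv (n1 - n0) (2^-1 *: (c1 + c0)).
Proof. by apply/rowP => i; rewrite !mxE; field. Qed.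

Lemma dotv_crossv_rotl a b u : dotv a (crossv b u) = dotv (crossv a b) u.
Proof. by rewrite !crossvE !dotvE !vec3_coord; ring. Qed.

Lemma dotv_crossv_rotr a b u : dotv a (crossv b u) = dotv (crossv u a) b.
Proof. by rewrite !crossvE !dotvE !vec3_coord; ring. Qed.

(** Here d and c stand for divergence and curl at the two levels, g for the gradient of the mean
    divergence, x2 and x3 for the outer curls in the discrete gradient. Squares are differenced by
    the midpoint rule and the increments of beta and omega by the Leibniz rule; each of the last
    three terms becomes a divergence. *)
Lemma oseen_frank_increment (k1 k2 k3 d0 d1 : R) (n0 n1 c0 c1 g x2 x3 : vec R) :
  let nh := 2^-1 *: (n1 + n0) in let ch := 2^-1 *: (c1 + c0) in
  let dh := 2^-1 * (d1 + d0) in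
  let bh := 2^-1 * (dotv n1 c1 + dotv n0 c0) in
  let oh := 2^-1 *: (crossv n1 c1 + crossv n0 c0) in
  let w := n1 - n0 in
  2^-1 * (k1 * d1 ^+ 2 + k2 * dotv n1 c1 ^+ 2
      + k3 * dotv (crossv n1 c1) (crossv n1 c1)
    - (k1 * d0 ^+ 2 + k2 * dotv n0 c0 ^+ 2
      + k3 * dotv (crossv n0 c0) (crossv n0 c0)))
  = dotv (- (k1 *: g) + k2 *: (bh *: ch + x2) + k3 *: (crossv ch oh + x3)) w
    + k1 * ((d1 - d0) * dh + dotv w g)
    + k2 * (dotv (bh *: nh) (c1 - c0) - dotv w x2)
    + k3 * (dotv (crossv oh nh) (c1 - c0) - dotv w x3).
Proof.
move=> /=.
have H3 := dotv_midpoint (crossv n0 c0) (crossv n1 c1).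
have H2 := dotv_increment n0 n1 c0 c1.
(* With w = n1 - n0, cyclic rotation gives oh . (nh x (c1 - c0)) = (oh x nh) . (c1 - c0) and oh . (w
   x ch) = (ch x oh) . w. *)
rewrite crossv_increment dotvDr dotv_crossv_rotl (dotv_crossv_rotr _ (n1 - n0)) in H3.
move: H2 H3; rewrite !(dotvC _ (n1 - n0)) !(dotvDr, dotvNr, dotvZr, dotvZl).
move: (crossv _ (2^-1 *: (n1 + n0))) (crossv (2^-1 *: (c1 + c0)) _) => o1 o2.
move: (dotv n1 c1) (dotv n0 c0) => b1 b0 H2 H3.
transitivity (2^-1 * (k1 * (d1 ^+ 2 - d0 ^+ 2)) + k2 * (2^-1 * (b1 + b0)) * (b1 - b0)
  + k3 * (2^-1 * (dotv (crossv n1 c1) (crossv n1 c1)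
                  - dotv (crossv n0 c0) (crossv n0 c0)))); first by ring.
by rewrite H2 -H3; ring.
Qed.

(* After the product rule the right-hand side is a sum of divergences. *)
Lemma step_algebra (c : material R) (dt : R) (v0 v1 n0 n1 D gP lap dS : vec R)
    (G GN : 'M[R]_3) :
  0 < Rey c -> 0 < gam c < 1 -> al2 c + al3 c = al6 c - al5 c -> 0 < gam1 c ->
  0 <= al4 c -> 0 <= al1 c + gam2 c ^+ 2 / gam1 c ->
  0 <= al5 c + al6 c - gam2 c ^+ 2 / gam1 c -> 0 < dt ->
  let vh := 2^-1 *: (v1 + v0) in let nh := 2^-1 *: (n1 + n0) in
  let q := crossv (crossv nh D) nh in
  let t := sympart G in
  let s := ((al1 c + gam2 c ^+ 2 / gam1 c) * ddot (tensv nh nh) t) *: tensv nh nh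
    - (al2 c / gam1 c) *: tensv nh q - (al3 c / gam1 c) *: tensv q nh + al4 c *: t
    + ((al5 c + al6 c) / 2 - gam2 c ^+ 2 / (2 * gam1 c))
      *: (tensv nh (mulmv t nh) + tensv (mulmv t nh) nh) in
  let A := Rey c / (1 - gam c) in
  dt^-1 *: (v1 - v0) = - (vh *m G) - gP + (gam c / Rey c) *: lap
    + ((1 - gam c) / Rey c) *: dS + ((1 - gam c) / Rey c) *: mulmv GN q ->
  dt^-1 *: (n1 - n0) = - ((gam1 c)^-1 *: crossv (crossv nh
    (D + gam1 c *: (vh *m GN + mulmv (skewpart G) nh) + gam2 c *: mulmv t nh)) nh) ->
  A * (2^-1 * (dotv v1 v1 - dotv v0 v0)) + dotv D (n1 - n0)
  <= dt * (A * (- dotv vh (vh *m G) - dotv vh gP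
                + gam c / Rey c * (dotv vh lap + ddot G G))
           + (dotv vh dS + ddot s G)).
Proof.
move=> Re0 /andP[g0 g1] parodi gam10 a4 a1 a56 dt0 vh nh q t s A Hv Hn.
have dtn : dt != 0 by rewrite gt_eqF.
have -> : n1 - n0 = dt *: (dt^-1 *: (n1 - n0)) by rewrite scalerA divff// scale1r.
rewrite Hn -dotv_midpoint -/vh.
have -> : v1 - v0 = dt *: (dt^-1 *: (v1 - v0)) by rewrite scalerA divff// scale1r.
(* By symmetry the double cross product passes from the bracket of the director equation to D, which
   turns D into q. *)
rewrite Hv /s ddot_leslie -/t !(dotvZr, dotvNr) dot_double_cross -/q.
have qD : 0 <= dotv D q by rewrite dot_double_cross_self dotvv_ge0.
clear Hv Hn; clearbody vh q t; clear s; clearbody nh.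
rewrite !(dotvDr, dotvNr, dotvZr, dotvDl, dotvZl) (dotv_mulmv vh).
rewrite (dotvC q (mulmv (skewpart G) nh)) (dotvC q (mulmv t nh)).
have GG := ddot_ge0 G; have tt := ddot_ge0 t; have ww := dotvv_ge0 (mulmv t nh).
move: (ddot G G) (ddot t t) (dotv (mulmv t nh) (mulmv t nh)) (dotv D q) GG tt ww qD
  => GG tt ww qD GG0 tt0 ww0 qD0.
move: (dotv vh (vh *m G)) (dotv vh gP) (dotv vh lap) (dotv vh dS)
  (dotv (vh *m GN) q) (dotv (mulmv (skewpart G) nh) q) (dotv (mulmv t nh) q)
  (dotv nh (mulmv t nh)) => S1 S2 S3 S4 a o tq nt.
have gn : gam1 c != 0 by rewrite gt_eqF.
have Rn : Rey c != 0 by rewrite gt_eqF.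
have gm : 1 - gam c != 0 by rewrite subr_eq0 gt_eqF.
(* By Parodi's relation gam2 = al2 + al3, and gam1 = al3 - al2 by definition; solving for al2 and
   al3 makes the mixed terms in q cancel. *)
have E2 : al2 c = (gam2 c - gam1 c) / 2 by rewrite /gam1 /gam2 -parodi; field.
have E3 : al3 c = (gam2 c + gam1 c) / 2 by rewrite /gam1 /gam2 -parodi; field.
(* What remains is the dissipation: viscous, three Leslie terms, and the director relaxation D . q /
   gam1. *)
rewrite -subr_ge0 [leRHS](_ : _ = dt * (gam c / (1 - gam c) * GG
  + (al1 c + gam2 c ^+ 2 / gam1 c) * nt ^+ 2 + al4 c * tt
  + (al5 c + al6 c - gam2 c ^+ 2 / gam1 c) * ww + (gam1 c)^-1 * qD)).
  have g2 : 0 <= gam c / (1 - gam c) by rewrite divr_ge0 ?subr_ge0 ?ltW.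
  apply: mulr_ge0; first exact: ltW.
  apply: addr_ge0; last by apply: mulr_ge0 => //; rewrite invr_ge0 ltW.
  apply: addr_ge0; last exact: mulr_ge0.
  apply: addr_ge0; last exact: mulr_ge0.
  apply: addr_ge0; first exact: mulr_ge0.
  by apply: mulr_ge0 => //; exact: sqr_ge0.
rewrite /A E2 E3; move: (gam1 c) (gam2 c) gn => m1 m2 gn.
by field; rewrite ?Rn ?gm ?gn.
Qed.

End energy_algebra.

Lemma energy_balance (R : realFieldType) (r k0 k1 d0 d1 : R) :
  (r * 2^-1 * k1 + (- (r * 2^-1)) * k0) + (2^-1 * d1 + (- 2^-1) * d0) <= 0 ->
  r * 2^-1 * k1 + 2^-1 * d1 <= r * 2^-1 * k0 + 2^-1 * d0.
Proof. lra. Qed.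

(** * Energy inequality under an abstract no-flux condition *)

Section energy_step.
Context {R : realType}.
Variables (U Om : set (vec R)) (l : vec R) (Z : (vec R -> R) -> Prop).
Hypotheses (oU : open U) (OU : Om `<=` U) (oO : open Om) (bO : bounded_set Om).
Implicit Types (f g z : vec R -> R) (u v w b n : vec R -> vec R) (i j : 'I_3) (x : vec R).
Local Notation reg := (reg U Om l).
Local Notation regv := (regv U Om l).
Local Notation null := (null U Om).
(** This is where the boundary conditions enter: Z is instantiated by [vanishing Omega] for
    Dirichlet data and by the trivial predicate for periodic data. *)
Hypothesis flux : forall i z f, Z z -> reg 1 z -> reg 1 f ->
  int3 Om (pd i (fun x => z x * f x)) = 0.

Lemma null_flux i z f : Z z -> reg 1 z -> reg 1 f -> null (pd i (fun x => z x * f x)).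
Proof.
move=> Zz rz rf; split; last exact: flux.
by apply: (@reg_cont _ U Om l 0); apply: reg_pd; exact: regM.
Qed.

Lemma nullB f g : null f -> null g -> null (fun x => f x - g x).
Proof.
move=> nf ng; under eq_fun do rewrite -mulN1r.
by apply: nullD => //; exact: nullZ.
Qed.

Lemma null_flux_cross w b :
  (forall j, Z (fun x => w x 0 j)) -> regv 1 w -> regv 1 b ->
  null (fun x => \sum_i (pd i (fun y => w y 0 (i + 1) * b y 0 (i + 2)) x
          - pd i (fun y => w y 0 (i + 2) * b y 0 (i + 1)) x)).
Proof.
move=> Zw rw rb; apply: null_sum => // i; apply: nullB.
  exact: (null_flux _ (Zw _) (rw _) (rb _)).
exact: (null_flux _ (Zw _) (rw _) (rb _)).
Qed.

(** Writes the power of the convection term as v . grad (|v|^2 / 2), which is a divergence when div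
    v = 0. *)
Lemma grad_half_dotv v x : U x -> regv 1 v ->
  dotv (v x) (grad (fun y => 2^-1 * dotv (v y) (v y)) x)
  = dotv (v x) (v x *m gradv v x).
Proof.
move=> Ux rv.
have H i : pd i (fun y => 2^-1 * dotv (v y) (v y)) x
    = v x 0 0 * gradv v x i 0 + v x 0 1 * gradv v x i 1 + v x 0 2 * gradv v x i 2.
  rewrite (pdZ_reg oU OU Ux _ _ (reg_dotv oU OU rv rv)).
  have -> : (fun y => dotv (v y) (v y)) = (fun y => v y 0 0 * v y 0 0
      + v y 0 1 * v y 0 1 + v y 0 2 * v y 0 2) by apply/funext => y; rewrite dotvE.
  have rM j : reg 1 (fun y => v y 0 j * v y 0 j) by exact: regM.
  rewrite (pdD_reg Ux _ (regD oU OU (rM 0) (rM 1)) (rM 2)).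
  rewrite (pdD_reg Ux _ (rM 0) (rM 1)) !(pdM_coord Ux _ _ _ rv rv).
  by move: (gradv v x) (v x) => G V; field.
rewrite !dotvE !mxE !sum3 !H.
by move: (gradv v x) (v x) => G V; ring.
Qed.

Variables (c : material R) (dt : R) (v0 v1 n0 n1 : vec R -> vec R) (P : vec R -> R).
Hypotheses (rv0 : regv 2 v0) (rv1 : regv 2 v1) (rn0 : regv 3 n0) (rn1 : regv 3 n1)
  (rP : reg 1 P).
Hypotheses (Zv : forall j, Z (fun x => mid v0 v1 x 0 j))
  (Zw : forall j, Z (fun x => (n1 x - n0 x) 0 j)).
Hypotheses (Re0 : 0 < Rey c) (g01 : 0 < gam c < 1)
  (parodi : al2 c + al3 c = al6 c - al5 c) (gam10 : 0 < gam1 c)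
  (a4 : 0 <= al4 c) (a1 : 0 <= al1 c + gam2 c ^+ 2 / gam1 c)
  (a56 : 0 <= al5 c + al6 c - gam2 c ^+ 2 / gam1 c) (dt0 : 0 < dt).
Hypotheses (mom : momentum_eq c Om dt v0 v1 n0 n1 P)
  (dir : director_eq c Om dt v0 v1 n0 n1)
  (div0 : forall x, Om x -> divv v0 x = 0) (div1 : forall x, Om x -> divv v1 x = 0).

Let vh := mid v0 v1.
Let nh := mid n0 n1.
Let w x := n1 x - n0 x.
Let bh : vec R -> R := mid (V := R^o) (beta n0) (beta n1).
Let oh := mid (omega n0) (omega n1).
Let A := Rey c / (1 - gam c).
Let b2 x := bh x *: nh x.
Let b3 x := crossv (oh x) (nh x).
Let density n x := kap1 c * divv n x ^+ 2 + kap2 c * beta n x ^+ 2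
  + kap3 c * enorm (omega n x) ^+ 2.
Let increment x := A * (2^-1 * (enorm (v1 x) ^+ 2 - enorm (v0 x) ^+ 2))
  + 2^-1 * (density n1 x - density n0 x).
(** The bound of [step_algebra] plus the remainder of [oseen_frank_increment], both put in
    divergence form: every product has a component of vh or of w as its first factor. *)
Let net_flux x :=
  dt * (A * (- \sum_i pd i (fun y => vh y 0 i * (2^-1 * dotv (vh y) (vh y))) x
             - \sum_i pd i (fun y => vh y 0 i * P y) x
             + gam c / Rey c *
               \sum_i \sum_j pd i (fun y => vh y 0 j * pd i (fun y => vh y 0 j) y) x)
        + \sum_i \sum_j pd i (fun y => vh y 0 j * leslie_stress c v0 v1 n0 n1 y i j) x)
  + (kap1 c * \sum_i pd i (fun y => w y 0 i * divv nh y) x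
  + kap2 c * \sum_i (pd i (fun y => w y 0 (i + 1) * b2 y 0 (i + 2)) x
          - pd i (fun y => w y 0 (i + 2) * b2 y 0 (i + 1)) x)
  + kap3 c * \sum_i (pd i (fun y => w y 0 (i + 1) * b3 y 0 (i + 2)) x
          - pd i (fun y => w y 0 (i + 2) * b3 y 0 (i + 1)) x)).

Let rvh : regv 2 vh. Proof. exact: regv_mid. Qed.
Let rnh : regv 3 nh. Proof. exact: regv_mid. Qed.
Let rw : regv 3 w. Proof. exact: regvB. Qed.
Let rbh : reg 2 bh.
Proof. exact: (reg_mid oU OU (reg_beta oU OU rn0) (reg_beta oU OU rn1)). Qed.
Let roh : regv 2 oh.
Proof. exact: (regv_mid oU OU (regv_omega oU OU rn0) (regv_omega oU OU rn1)). Qed.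
Let rb2 : regv 2 b2. Proof. exact: (regvM oU OU rbh (regvS rnh)). Qed.
Let rb3 : regv 2 b3. Proof. exact: (regv_crossv oU OU roh (regvS rnh)). Qed.
Let rw1 : regv 1 w := regvS (regvS rw).
Let rvh1 : regv 1 vh := regvS rvh.
Let rdiv : reg 1 (divv nh). Proof. exact: (regS (reg_divv oU OU rnh)). Qed.

Let null_net_flux : null net_flux.
Proof.
have rK : reg 1 (fun y => 2^-1 * dotv (vh y) (vh y)).
  exact: (regZ oU OU _ (reg_dotv oU OU rvh1 rvh1)).
have rS := regm_leslie_stress oU OU c rn0 rn1 rv0 rv1.
apply: nullD => //; last first.
  apply: nullD => //; first apply: nullD => //; apply: nullZ => //.
  - by apply: null_sum => // i; apply: null_flux.
  - exact: (null_flux_cross Zw rw1 (regvS rb2)).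
  - exact: (null_flux_cross Zw rw1 (regvS rb3)).
apply: nullZ => //; apply: nullD => //.
  apply: nullZ => //; apply: nullD => //; first apply: nullB.
  - under eq_fun do rewrite -mulN1r; apply: nullZ => //.
    by apply: null_sum => // i; apply: null_flux.
  - by apply: null_sum => // i; apply: null_flux.
  - apply: nullZ => //; do 2 (apply: null_sum => // ?); apply: null_flux => //.
    by apply: reg_pd; exact: rvh.
by do 2 (apply: null_sum => // ?); apply: null_flux.
Qed.

Let increment_le x : Om x -> increment x <= net_flux x.
Proof.
move=> Ox; have Ux := OU Ox.
have r2 u : regv 3 u -> regv 1 u by move=> H; do 2 apply: regvS.
have rK : reg 1 (fun y => 2^-1 * dotv (vh y) (vh y)).
  exact: (regZ oU OU _ (reg_dotv oU OU rvh1 rvh1)).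
have rS := regm_leslie_stress oU OU c rn0 rn1 rv0 rv1.
(* Incompressibility at both levels removes the extra terms of the convection and pressure
   fluxes. *)
have dvh : divv vh x = 0.
  by rewrite (divv_mid oU OU Ux (regvS rv0) (regvS rv1)) div0// div1// addr0 mulr0.
have flux1 : net_flux x =
  dt * (A * (- dotv (vh x) (vh x *m gradv vh x) - dotv (vh x) (grad P x)
             + gam c / Rey c * (dotv (vh x) (laplv vh x)
                                + ddot (gradv vh x) (gradv vh x)))
        + (dotv (vh x) (divm (leslie_stress c v0 v1 n0 n1) x)
           + ddot (leslie_stress c v0 v1 n0 n1 x) (gradv vh x)))
  + (kap1 c * (divv w x * divv nh x + dotv (w x) (grad (divv nh) x))
     + kap2 c * (dotv (b2 x) (curl w x) - dotv (w x) (curl b2 x))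
     + kap3 c * (dotv (b3 x) (curl w x) - dotv (w x) (curl b3 x))).
  rewrite /net_flux (sum_pd_scale Ux rvh1 rK) (sum_pd_scale Ux rvh1 rP).
  rewrite (sum_pd_laplacian Ux rvh) (sum_pd_stress Ux rvh1 rS).
  rewrite (sum_pd_scale Ux rw1 rdiv) (sum_pd_cross Ux rw1 (regvS rb2)).
  by rewrite (sum_pd_cross Ux rw1 (regvS rb3)) dvh !mul0r !add0r grad_half_dotv.
have OF := oseen_frank_increment (kap1 c) (kap2 c) (kap3 c) (divv n0 x) (divv n1 x)
  (n0 x) (n1 x) (curl n0 x) (curl n1 x) (grad (divv nh) x) (curl b2 x) (curl b3 x).
have step := step_algebra (D := discrete_gradient c n0 n1 x) Re0 g01 parodi gam10 a4 a1 a56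
  dt0 (mom Ox) (dir Ox).
have DE : discrete_gradient c n0 n1 x = - (kap1 c *: grad (divv nh) x)
    + kap2 c *: (bh x *: curl nh x + curl b2 x)
    + kap3 c *: (crossv (curl nh x) (oh x) + curl b3 x) by [].
have cn : curl nh x = 2^-1 *: (curl n1 x + curl n0 x).
  exact: (curl_mid oU OU Ux (r2 _ rn0) (r2 _ rn1)).
have dn : divv nh x = 2^-1 * (divv n1 x + divv n0 x).
  exact: (divv_mid oU OU Ux (r2 _ rn0) (r2 _ rn1)).
have cw : curl w x = curl n1 x - curl n0 x.
  exact: (curl_sub oU OU Ux (r2 _ rn0) (r2 _ rn1)).
have dw : divv w x = divv n1 x - divv n0 x.
  exact: (divv_sub oU OU Ux (r2 _ rn0) (r2 _ rn1)).
have densE u : density u x = kap1 c * divv u x ^+ 2 + kap2 c * dotv (u x) (curl u x) ^+ 2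
    + kap3 c * dotv (crossv (u x) (curl u x)) (crossv (u x) (curl u x)).
  by rewrite /density (enorm_sqr (omega u x)).
have incE : increment x = A * (2^-1 * (dotv (v1 x) (v1 x) - dotv (v0 x) (v0 x)))
    + 2^-1 * (density n1 x - density n0 x).
  by rewrite /increment (enorm_sqr (v1 x)) (enorm_sqr (v0 x)).
rewrite flux1 incE !densE [X in _ + X <= _]OF -dn -cn -cw -dw.
(* The term D . w is grouped with the kinetic increment, where [step] bounds the sum; the other
   three terms agree on both sides. *)
have assoc (r d p q k : R) : r + (d + p + q + k) = r + d + (p + q + k) by ring.
by rewrite assoc; apply: lerD; [exact: step|exact: lexx].
Qed.

Lemma energy_step :
  Rey c / (2 * (1 - gam c)) * L2norm Om v1 ^+ 2 + oseen_frank c Om n1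
  <= Rey c / (2 * (1 - gam c)) * L2norm Om v0 ^+ 2 + oseen_frank c Om n0.
Proof.
have r20 k u : regv k.+1 u -> reg k.+1 (fun x => enorm (u x) ^+ 2).
  by move=> ru; under eq_fun do rewrite enorm_sqr; exact: reg_dotv.
have ck0 := reg_cont (r20 _ _ rv0); have ck1 := reg_cont (r20 _ _ rv1).
have cd0 : cont_bounded U Om (density n0) :=
  reg_cont (reg_oseen_frank_density oU OU c rn0).
have cd1 : cont_bounded U Om (density n1) :=
  reg_cont (reg_oseen_frank_density oU OU c rn1).
have cZ (r : R) f : cont_bounded U Om f -> cont_bounded U Om (fun x => r * f x).
  exact: (cont_boundedM (cont_bounded_cst _ _ r)).
have ckk := cont_boundedD (cZ (A * 2^-1) _ ck1) (cZ (- (A * 2^-1)) _ ck0).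
have cdd := cont_boundedD (cZ 2^-1 _ cd1) (cZ (- 2^-1) _ cd0).
(* The integrand is [increment] expanded into scalar multiples, the shape to which [int3D] and
   [int3Z] apply. *)
have : int3 Om (fun x =>
    (A * 2^-1 * enorm (v1 x) ^+ 2 + (- (A * 2^-1)) * enorm (v0 x) ^+ 2)
    + (2^-1 * density n1 x + (- 2^-1) * density n0 x)) <= 0.
  have [cN <-] := null_net_flux.
  apply: (le_int3 oO bO OU (cont_boundedD ckk cdd) cN) => x Ox.
  have -> : forall p q r k : R, A * 2^-1 * p + - (A * 2^-1) * q + (2^-1 * r + - 2^-1 * k)
    = A * (2^-1 * (p - q)) + 2^-1 * (r - k) by move=> *; ring.
  exact: increment_le.
have -> : int3 Om (fun x =>
    (A * 2^-1 * enorm (v1 x) ^+ 2 + (- (A * 2^-1)) * enorm (v0 x) ^+ 2)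
    + (2^-1 * density n1 x + (- 2^-1) * density n0 x)) =
    (A * 2^-1 * int3 Om (fun x => enorm (v1 x) ^+ 2)
     + (- (A * 2^-1)) * int3 Om (fun x => enorm (v0 x) ^+ 2))
    + (2^-1 * int3 Om (density n1) + (- 2^-1) * int3 Om (density n0)).
  rewrite (int3D oO bO OU ckk cdd); congr (_ + _).
    rewrite (int3D oO bO OU (cZ _ _ ck1) (cZ _ _ ck0)).
    by congr (_ + _); [exact: (int3Z oO bO OU _ ck1)|exact: (int3Z oO bO OU _ ck0)].
  rewrite (int3D oO bO OU (cZ _ _ cd1) (cZ _ _ cd0)).
  by congr (_ + _); [exact: (int3Z oO bO OU _ cd1)|exact: (int3Z oO bO OU _ cd0)].
have L2E u : L2norm Om u ^+ 2 = int3 Om (fun x => enorm (u x) ^+ 2).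
  rewrite /L2norm sqr_sqrtr//; apply: int3_ge0 => x _; exact: sqr_ge0.
have ofE u : oseen_frank c Om u = 2^-1 * int3 Om (density u) by [].
have -> : Rey c / (2 * (1 - gam c)) = A * 2^-1.
  by rewrite /A; move: g01 => /andP[_ g1]; field; rewrite subr_eq0 gt_eqF.
rewrite !L2E !ofE; exact: energy_balance.
Qed.

End energy_step.

Section unit_length.
Context {R : realType}.

Lemma director_step_enorm (c : material R) (Om : set (vec R)) (dt : R)
    (v0 v1 n0 n1 : vec R -> vec R) (x : vec R) :
  0 < dt -> director_eq c Om dt v0 v1 n0 n1 -> Om x ->
  enorm (n1 x) = enorm (n0 x).
Proof.
move=> dt0 dir Ox; rewrite /enorm; congr Num.sqrt; apply/eqP.
rewrite -subr_eq0 -(mulrI_eq0 _ (mulfI (x := 2^-1) _)) ?invr_eq0//.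
have -> : 2^-1 * (dotv (n1 x) (n1 x) - dotv (n0 x) (n0 x))
    = dt * dotv (mid n0 n1 x) (dt^-1 *: (n1 x - n0 x)).
  by rewrite dotvZr dotv_midpoint mulrA divff ?mul1r// gt_eqF.
by rewrite (dir _ Ox) dotvNr dotvZr dot_cross_self !(mulr0, oppr0).
Qed.

End unit_length.

(** * Fields tending to zero at the boundary *)

Section boundary_conditions.
Context {R : realType}.
Implicit Types (Om : set (vec R)) (u : vec R -> vec R) (f : vec R -> R).

(** Only values of f inside Om count. The condition is void at points outside the closure, so it
    describes the limit 0 at the boundary. *)
Definition vanishing Om f := forall x, ~ Om x -> forall e, 0 < e ->
  \forall y \near x, Om y -> `|f y| < e.

Lemma within_vanishing Om f : {within closure Om, continuous f} ->
  (forall x, (closure Om `\` Om) x -> f x = 0) -> vanishing Om f.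
Proof.
move=> cf f0 x nOx e e0; have [cx|ncx] := pselect (closure Om x); last first.
  have : \forall y \near x, (~` closure Om) y.
    by apply: near_open => //; exact/closed_openC/closed_closure.
  by apply: filterS => y ny Oy; case: ny; exact: subset_closure.
have fx0 : f x = 0 by exact: f0.
have /cvgrPdist_lt/(_ e e0) := (subspace_continuousP _ _).1 cf x cx.
rewrite near_withinE => H; apply: filterS H => y Hy Oy.
have : `|f x - f y| < e by apply: Hy; exact: subset_closure.
by rewrite fx0 sub0r normrN.
Qed.

Lemma within_continuous_lin (A : set (vec R)) (r s : R) f g :
  {within A, continuous f} -> {within A, continuous g} ->
  {within A, continuous (fun x => r * f x + s * g x)}.
Proof.
move=> cf cg x; apply: cvgD; apply: cvgMr; [exact: cf|exact: cg].
Qed.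

Lemma vanishingM Om f g : open Om -> vanishing Om f -> bounded_on Om g ->
  vanishing Om (fun x => f x * g x).
Proof.
move=> oO vf [M gM] x nOx e e0.
have M0 : 0 < `|M| + 1 by rewrite ltr_wpDl.
apply: filterS (vf x nOx (e / (`|M| + 1)) (divr_gt0 e0 M0)) => y H Oy.
rewrite normrM (le_lt_trans (ler_wpM2l (normr_ge0 _) (gM _ Oy)))//.
rewrite (le_lt_trans (y := `|f y| * (`|M| + 1)))//.
  by rewrite ler_wpM2l// (le_trans (ler_norm _))// lerDl.
by rewrite -ltr_pdivlMr//; exact: H.
Qed.

Lemma periodic0 (T : Type) (u : vec R -> T) : periodic_field 0 u.
Proof. by move=> i x; rewrite mxE scale0r addr0. Qed.

End boundary_conditions.

Unset Implicit Arguments.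

Theorem theorem1 (R : realType) (c : material R) (Omega : set (vec R))
  (dt : nat -> R) (v n : nat -> vec R -> vec R) (P : nat -> vec R -> R)
  (hRey : 0 < Rey c)
  (hgam : 0 < gam c < 1)
  (hparodi : al2 c + al3 c = al6 c - al5 c)
  (hgam1 : 0 < gam1 c)
  (hal4 : 0 <= al4 c)
  (hal1 : 0 <= al1 c + gam2 c ^+ 2 / gam1 c)
  (hal56 : 0 <= al5 c + al6 c - gam2 c ^+ 2 / gam1 c)
  (hOmega : bounded_domain Omega)
  (hdt : forall m, 0 < dt m)
  (hscheme : forall m,
     midpoint_step c Omega (dt m) (v m) (v m.+1) (n m) (n m.+1) (P m))
  (hn0 : forall x, Omega x -> enorm (n 0%N x) = 1)
  (hv0 : forall x, Omega x -> divv (v 0%N) x = 0)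
  (hbc : smooth_fields Omega v n P /\ dirichlet_bc Omega v n \/
         smooth_fields setT v n P /\ periodic_bc Omega v n P) :
  forall m : nat,
    (forall x, Omega x -> enorm (n m.+1 x) = 1) /\
    Rey c / (2 * (1 - gam c)) * L2norm Omega (v m.+1) ^+ 2
      + oseen_frank c Omega (n m.+1)
    <= Rey c / (2 * (1 - gam c)) * L2norm Omega (v m) ^+ 2
      + oseen_frank c Omega (n m).
Proof.
have [_ oO _ bO] := hOmega.
have unit m x : Omega x -> enorm (n m x) = 1.
  move=> Ox; elim: m => [|m IH]; first exact: hn0.
  by have [_ dir _] := hscheme m; rewrite (director_step_enorm (hdt m) dir Ox).
have divv0 m x : Omega x -> divv (v m) x = 0.
  by case: m => [|m]; [exact: hv0|have [_ _] := hscheme m; exact].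
move=> m; split; first exact: unit.
have [mom dir _] := hscheme m.
case: hbc => [[sm [g2 bc]]|[sm [a [b [ab OE per]]]]].
- have OO : Omega `<=` Omega by [].
  have regP k f : Ck Omega k f -> reg Omega Omega 0 k f.
    by move=> Cf; split; [exact: Ck_smooth|exact: periodic0].
  have [v2 n3 P1] := sm m; have [v2' n3' _] := sm m.+1.
  apply: (@energy_step _ Omega Omega 0 (vanishing Omega) oO OO oO bO _ c (dt m)
    _ _ _ _ (P m)) => //; try by [move=> j; exact: regP|exact: regP|exact: divv0].
  (* The product tends to 0 at the boundary because z does and f is bounded. *)
  + move=> i z f Vz [rz pz] [rf pf]; apply: int3_pd_vanishing => //.
      exact: smoothM.
    by apply: vanishingM => //; have [] := smooth0 rf.
  + move=> j; apply: within_vanishing => [|x bx].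
      rewrite (_ : (fun x => _) = fun x => 2^-1 * v m.+1 x 0 j + 2^-1 * v m x 0 j).
        by apply: within_continuous_lin; [have [] := v2' j|have [] := v2 j].
      by apply/funext => x; rewrite !mxE mulrDr.
    have [vx _] := bc m x bx; have [vx' _] := bc m.+1 x bx.
    by rewrite /mid vx vx' addr0 scaler0 mxE.
  (* The director increment vanishes on the boundary since the data g2 are the same at both time
     levels. *)
  + move=> j; apply: within_vanishing => [|x bx].
      rewrite (_ : (fun x => _) = fun x => 1 * n m.+1 x 0 j + -1 * n m x 0 j).
        by apply: within_continuous_lin; [have [] := n3' j|have [] := n3 j].
      by apply/funext => x; rewrite !mxE mul1r mulN1r.
    have [_ nx] := bc m x bx; have [_ nx'] := bc m.+1 x bx.
    by rewrite nx nx' subrr mxE.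
- have OT : Omega `<=` setT by [].
  have regP k f : Ck setT k f -> periodic_field (b - a) f -> reg setT Omega (b - a) k f.
    by move=> Cf pf; split=> //; apply: Ck_smooth => //; exact: openT.
  have regPv k u : Ckv setT k u -> periodic_field (b - a) u -> regv setT Omega (b - a) k u.
    by move=> Cu pu j; apply: regP => // i x; rewrite pu.
  have [v2 n3 P1] := sm m; have [v2' n3' _] := sm m.+1.
  have [pv pn pP] := per m; have [pv' pn' _] := per m.+1.
  apply: (@energy_step _ setT Omega (b - a) (fun=> True) openT OT oO bO _ c (dt m)
    _ _ _ _ (P m)) => //; try by [exact: regPv|exact: regP|exact: divv0].
  (* Here the periodicity of the product z * f replaces any boundary value of z. *)
  move=> i z f _ [rz pz] [rf pf]; have OE' : Omega = box a b := OE.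
  move: oO bO OT rz rf; rewrite OE' => oO bO OT rz rf.
  apply: (@int3_pd_periodic _ a b _ i ab) => //; first by apply: smoothM => //; exact: openT.
  by move=> j x; rewrite pz pf.
Qed.
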